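(* Let $A,B,C\in\mathbb{Z}$ and $F(x,y)=Ax^4+Bx^3y+(C+2A)x^2y^2+Bxy^3+Ay^4$. (a) For an odd prime $p$, $Q_F$ is maximal at $p$ if and only if $p$ does not divide all of $A,B,C$, and $4A+2B+C,\ 4A-2B+C,\ B^2-4AC\not\equiv0\pmod{p^2}$. (b) $Q_F$ is maximal at $2$ if and only if $A,B,C$ are not all even, $2B+C\not\equiv 0\pmod 4$, and, when $C$ is odd and $B$ is even, $A\not\equiv0\pmod4$ and $A-B+C\not\equiv0\pmod 4$.
   Context: For an integral binary quartic form $F=a_4x^4+a_3x^3y+a_2x^2y^2+a_1xy^3+a_0y^4$, $Q_F$ is the quartic ring associated to $F$ by Birch–Merriman/Nakagawa (equivalently, by Wood, the quartic ring corresponding under Bhargava's parametrization to the pair of ternary quadratic forms $(U_0,V_F)$ with $U_0=-xy+z^2$, $V_F=a_0x^2+a_4y^2+a_2z^2+a_1xz+a_3yz$); when $F$ is irreducible and $\theta$ is a root of $F(x,1)$, $Q_F=\mathbb{Z}\oplus\mathbb{Z}a_4\theta\oplus\mathbb{Z}(a_4\theta^2+a_3\theta)\oplus\mathbb{Z}(a_4\theta^3+a_3\theta^2+a_2\theta)$. $Q_F$ is maximal at a prime $p$ if $\mathbb{Z}_p\otimes_{\mathbb{Z}}Q_F$ is a maximal quartic ring over $\mathbb{Z}_p$. *)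

(* Defs.v *)
From HB Require Import structures.
From Stdlib Require Import FunctionalExtensionality.
From mathcomp Require Import all_boot all_order all_algebra.
From mathcomp Require Import ring.
From mathcomp Require Import boolp.

Set Implicit Arguments.
Unset Strict Implicit.
Unset Printing Implicit Defensive.

Import GRing.Theory.
Local Open Scope ring_scope.

(** The inverse limit of the rings Z/p^(n+1). MathComp's ['Z_m] is Z/m only for
    [m > 1], hence the exponent [n.+1]. The ring structure below exists for every
    [p : nat], but [padic_int p] is the ring of p-adic integers only when [p] is
    prime (for [p <= 1] all the levels degenerate to Z/2). *)

Definition padic_red (p n : nat) (a : 'Z_(p ^ n.+2)) : 'Z_(p ^ n.+1) := inZp a.

Record padic_int (p : nat) := PadicInt {
  padic_level :> forall n : nat, 'Z_(p ^ n.+1);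
  padic_levelP : forall n, padic_red (padic_level n.+1) = padic_level n }.

Lemma padic_intP (p : nat) (x y : padic_int p) : (forall n, x n = y n) -> x = y.
Proof.
case: x y => [x xP] [y yP] /= exy.
have e : x = y by apply: functional_extensionality_dep.
by case: _ / e yP => yP; congr PadicInt; apply: Prop_irrelevance.
Qed.

Lemma padic_dvd (p n : nat) :
  ((Zp_trunc (p ^ n.+1)).+2 %| (Zp_trunc (p ^ n.+2)).+2)%N.
Proof.
case: p => [|[|p]]; first by rewrite !exp0n.
  by rewrite !exp1n.
have gt1 k : (1 < p.+2 ^ k.+1)%N by rewrite -(exp1n k.+1) ltn_exp2r.
by rewrite !Zp_cast // dvdn_exp2l.
Qed.

Lemma padic_redD (p n : nat) : {morph @padic_red p n : a b / a + b}.
Proof.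
by move=> a b; apply: val_inj; rewrite /= modn_dvdm ?padic_dvd // modnDm.
Qed.

Lemma padic_redM (p n : nat) : {morph @padic_red p n : a b / a * b}.
Proof.
by move=> a b; apply: val_inj; rewrite /= modn_dvdm ?padic_dvd // modnMm.
Qed.

Lemma padic_red0 (p n : nat) : @padic_red p n 0 = 0.
Proof. by apply: val_inj; rewrite /= mod0n. Qed.

Lemma padic_red1 (p n : nat) : @padic_red p n 1 = 1.
Proof. by apply: val_inj; rewrite /= modn_small. Qed.

Lemma padic_redN (p n : nat) : {morph @padic_red p n : a / - a}.
Proof.
by move=> a; apply/eqP; rewrite -addr_eq0 -padic_redD addNr padic_red0.
Qed.

HB.instance Definition _ (p : nat) := gen_eqMixin (padic_int p).
HB.instance Definition _ (p : nat) := gen_choiceMixin (padic_int p).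

Section PadicRing.
Variable p : nat.
Implicit Types x y z : padic_int p.

Definition padic_zero : padic_int p := PadicInt (@padic_red0 p).

Definition padic_one : padic_int p := PadicInt (@padic_red1 p).

Fact padic_opp_subproof x n : padic_red (- x n.+1) = - x n.
Proof. by rewrite padic_redN padic_levelP. Qed.
Definition padic_opp x := PadicInt (padic_opp_subproof x).

Fact padic_add_subproof x y n : padic_red (x n.+1 + y n.+1) = x n + y n.
Proof. by rewrite padic_redD !padic_levelP. Qed.
Definition padic_add x y := PadicInt (padic_add_subproof x y).

Fact padic_mul_subproof x y n : padic_red (x n.+1 * y n.+1) = x n * y n.
Proof. by rewrite padic_redM !padic_levelP. Qed.
Definition padic_mul x y := PadicInt (padic_mul_subproof x y).

Lemma padic_addA : associative padic_add.
Proof. by move=> x y z; apply: padic_intP => n /=; rewrite addrA. Qed.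

Lemma padic_addC : commutative padic_add.
Proof. by move=> x y; apply: padic_intP => n /=; rewrite addrC. Qed.

Lemma padic_add0 : left_id padic_zero padic_add.
Proof. by move=> x; apply: padic_intP => n /=; rewrite add0r. Qed.

Lemma padic_addN : left_inverse padic_zero padic_opp padic_add.
Proof. by move=> x; apply: padic_intP => n /=; rewrite addNr. Qed.

Lemma padic_mulA : associative padic_mul.
Proof. by move=> x y z; apply: padic_intP => n /=; rewrite mulrA. Qed.

Lemma padic_mulC : commutative padic_mul.
Proof. by move=> x y; apply: padic_intP => n /=; rewrite mulrC. Qed.

Lemma padic_mul1 : left_id padic_one padic_mul.
Proof. by move=> x; apply: padic_intP => n /=; rewrite mul1r. Qed.

Lemma padic_mulD : left_distributive padic_mul padic_add.
Proof. by move=> x y z; apply: padic_intP => n /=; rewrite mulrDl. Qed.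

Lemma padic_one_neq0 : padic_one != padic_zero.
Proof.
by apply/eqP => /(congr1 (fun x : padic_int p => x 0%N)) /= /eqP; rewrite oner_eq0.
Qed.

HB.instance Definition _ := GRing.isZmodule.Build (padic_int p)
  padic_addA padic_addC padic_add0 padic_addN.
HB.instance Definition _ := GRing.Zmodule_isComNzRing.Build (padic_int p)
  padic_mulA padic_mulC padic_mul1 padic_mulD padic_one_neq0.

End PadicRing.

Definition is_quartic_ring (R : comNzRingType) (S : comAlgType R) : Prop :=
  exists b : 'I_4 -> S,
    forall s : S, exists! c : 'rV[R]_4, s = \sum_(i < 4) c 0 i *: b i.

(** Not properly contained in any other quartic ring over R. *)
Definition maximal_quartic_ring (R : comNzRingType) (S : comAlgType R) : Prop :=
  is_quartic_ring S /\
  forall (T : comAlgType R) (f : {lrmorphism S -> T}),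
    is_quartic_ring T -> injective f -> forall t : T, exists s : S, f s = t.

(** [BQF a4 a3 a2 a1 a0] is a4 x^4 + a3 x^3 y + a2 x^2 y^2 + a1 x y^3 + a0 y^4. *)
Record bqf (R : Type) := BQF { a4 : R; a3 : R; a2 : R; a1 : R; a0 : R }.

Definition map_bqf (R S : Type) (f : R -> S) (F : bqf R) : bqf S :=
  BQF (f (a4 F)) (f (a3 F)) (f (a2 F)) (f (a1 F)) (f (a0 F)).

(** The row [(x0, x1, x2, x3)] stands for x0 + x1 w1 + x2 w2 + x3 w3, where
      w1 = a4 t,  w2 = a4 t^2 + a3 t,  w3 = a4 t^3 + a3 t^2 + a2 t
    for a root t of F(x,1). The multiplication table
      w1 w1 = - a3 w1 + a4 w2               w1 w2 = - a2 w1 + a4 w3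
      w1 w3 = - a0 a4 - a1 w1               w2 w3 = - a0 a3 - a0 w1 - a1 w2
      w2 w2 = - a0 a4 - a1 w1 - a2 w2 + a3 w3
      w3 w3 = - a0 a2 - a0 w2 - a1 w3
    follows from w1 = t a4, w2 = t (w1 + a3), w3 = t (w2 + a2) and
    t (w3 + a1) = - a0; it defines a ring for every F, irreducible or not. *)
Definition quartic_ring (R : comNzRingType) (F : bqf R) : Type := 'rV[R]_4.

Definition row4 (R : Type) (x0 x1 x2 x3 : R) : 'rV[R]_4 :=
  \row_(i < 4) nth x0 [:: x0; x1; x2; x3] i.

Section QuarticRing.
Variables (R : comNzRingType) (F : bqf R).
Local Notation QF := (quartic_ring F).
Local Notation a4 := (a4 F).
Local Notation a3 := (a3 F).
Local Notation a2 := (a2 F).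
Local Notation a1 := (a1 F).
Local Notation a0 := (a0 F).

HB.instance Definition _ := GRing.Lmodule.copy QF 'rV[R]_4.

Definition qone : QF := row4 1 0 0 0.

Definition qmul (x y : QF) : QF :=
  let c (z : 'rV[R]_4) (k : nat) := z 0 (inord k) in
  let x0 := c x 0%N in let y0 := c y 0%N in
  let s i := c x i * c y i in
  let m i j := c x i * c y j + c x j * c y i in
  row4
    (x0 * y0 - a0 * a4 * m 1%N 3%N - a0 * a4 * s 2%N - a0 * a3 * m 2%N 3%N
       - a0 * a2 * s 3%N)
    (m 0%N 1%N - a3 * s 1%N - a2 * m 1%N 2%N - a1 * m 1%N 3%N - a1 * s 2%N
       - a0 * m 2%N 3%N)
    (m 0%N 2%N + a4 * s 1%N - a2 * s 2%N - a1 * m 2%N 3%N - a0 * s 3%N)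
    (m 0%N 3%N + a4 * m 1%N 2%N + a3 * s 2%N - a1 * s 3%N).

Lemma row4E (x0 x1 x2 x3 : R) :
  (row4 x0 x1 x2 x3 0 (inord 0) = x0) * (row4 x0 x1 x2 x3 0 (inord 1) = x1) *
  (row4 x0 x1 x2 x3 0 (inord 2) = x2) * (row4 x0 x1 x2 x3 0 (inord 3) = x3).
Proof. by rewrite !mxE !inordK. Qed.

Lemma row4P (x y : 'rV[R]_4) :
  x 0 (inord 0) = y 0 (inord 0) -> x 0 (inord 1) = y 0 (inord 1) ->
  x 0 (inord 2) = y 0 (inord 2) -> x 0 (inord 3) = y 0 (inord 3) -> x = y.
Proof.
move=> e0 e1 e2 e3; apply/rowP => i; rewrite -[i]inord_val.
by case: i => [[|[|[|[|i]]]] //= lti].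
Qed.

Lemma qmulA : associative qmul.
Proof.
by move=> x y z; apply: row4P; rewrite /qmul !row4E; ring.
Qed.

Lemma qmulC : commutative qmul.
Proof. by move=> x y; apply: row4P; rewrite /qmul !row4E; ring. Qed.

Lemma qmul1 : left_id qone qmul.
Proof. by move=> x; apply: row4P; rewrite /qmul /qone !row4E; ring. Qed.

Lemma qmulD : left_distributive qmul +%R.
Proof.
by move=> x y z; apply: row4P; rewrite /qmul [RHS]mxE !row4E !mxE; ring.
Qed.

Lemma qone_neq0 : qone != 0.
Proof.
apply/eqP => /(congr1 (fun z : 'rV[R]_4 => z 0 (inord 0))).
by rewrite row4E mxE => /eqP; rewrite oner_eq0.
Qed.

HB.instance Definition _ := GRing.Zmodule_isComNzRing.Build QF
  qmulA qmulC qmul1 qmulD qone_neq0.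

Lemma qmulE (x y : QF) : x * y = qmul x y.
Proof. by []. Qed.

Lemma qscaleAl (a : R) (x y : QF) : a *: (x * y) = (a *: x) * y.
Proof.
by apply: row4P; rewrite [LHS]mxE !qmulE !row4E !mxE; ring.
Qed.

HB.instance Definition _ := GRing.Lmodule_isLalgebra.Build R QF qscaleAl.
HB.instance Definition _ := GRing.Lalgebra_isComAlgebra.Build R QF.

End QuarticRing.

Definition qbasis (R : comNzRingType) (F : bqf R) (i : 'I_4) : quartic_ring F :=
  delta_mx 0 i.

Lemma quartic_ringP (R : comNzRingType) (F : bqf R) :
  is_quartic_ring (quartic_ring F).
Proof.
exists (@qbasis R F) => s; exists s; split; first exact: row_sum_delta.
by move=> c ->; rewrite [RHS]row_sum_delta.
Qed.

(** If t is a root of F(x,1) in an R-algebra, then sending w1, w2, w3 to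
    a4 t, a4 t^2 + a3 t, a4 t^3 + a3 t^2 + a2 t is a ring homomorphism. *)
Lemma quartic_ring_root (R : comNzRingType) (F : bqf R) (S : comAlgType R) (t : S) :
  a4 F *: t ^+ 4 + a3 F *: t ^+ 3 + a2 F *: t ^+ 2 + a1 F *: t + a0 F *: 1 = 0 ->
  monoid_morphism (fun x : quartic_ring F =>
    x 0 (inord 0) *: 1 + x 0 (inord 1) *: (a4 F *: t)
    + x 0 (inord 2) *: (a4 F *: t ^+ 2 + a3 F *: t)
    + x 0 (inord 3) *: (a4 F *: t ^+ 3 + a3 F *: t ^+ 2 + a2 F *: t)).
Proof.
pose c : {rmorphism R -> S} := in_alg S.
have sA (a : R) (u : S) : a *: u = c a * u by rewrite /c /= mulr_algl.
rewrite !sA => Ft0.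
split; first by rewrite !row4E !scale0r scale1r !addr0.
move=> x y; rewrite qmulE !row4E !sA !(rmorphB c, rmorphD c, rmorphM c).
move: (c (x _ _)) (c (x _ _)) (c (x _ _)) (c (x _ _)) => x0 x1 x2 x3.
move: (c (y _ _)) (c (y _ _)) (c (y _ _)) (c (y _ _)) => y0 y1 y2 y3.
move: (c (a4 F)) (c (a3 F)) (c (a2 F)) (c (a1 F)) (c (a0 F)) Ft0
  => b4 b3 b2 b1 b0 Ft0.
have /eqP := Ft0; rewrite addr_eq0 mulr1 => /eqP e0.
have {}e0 : b0 = - (b4 * t ^+ 4 + b3 * t ^+ 3 + b2 * t ^+ 2 + b1 * t) by rewrite e0 opprK.
by rewrite e0; ring.
Qed.

(** The ring of the form F with its coefficients pushed forward along
    f : R -> S is S (x)_R Q_F: it is the free S-module on the same basis with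
    the same structure constants, and [base_changeP] is its universal
    property. *)
Section BaseChange.
Variables (R S : comNzRingType) (f : {rmorphism R -> S}) (F : bqf R).

Definition base_change (x : quartic_ring F) : quartic_ring (map_bqf f F) :=
  map_mx f x.

Lemma base_change_is_zmod_morphism : zmod_morphism base_change.
Proof. exact: map_mxB. Qed.

Lemma base_change_is_monoid_morphism : monoid_morphism base_change.
Proof.
split=> [|x y].
  by apply: row4P; rewrite [LHS]mxE !row4E ?rmorph0 ?rmorph1.
by apply: row4P; rewrite [LHS]mxE !qmulE !row4E !mxE;
   rewrite !(rmorphB, rmorphD, rmorphM).
Qed.

HB.instance Definition _ := GRing.isZmodMorphism.Build _ _ base_change
  base_change_is_zmod_morphism.
HB.instance Definition _ := GRing.isMonoidMorphism.Build _ _ base_change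
  base_change_is_monoid_morphism.

Lemma base_change_scale (a : R) (x : quartic_ring F) :
  base_change (a *: x) = f a *: base_change x.
Proof. exact: map_mxZ. Qed.

Lemma base_change_basis (i : 'I_4) :
  base_change (qbasis F i) = qbasis (map_bqf f F) i.
Proof. exact: map_delta_mx. Qed.

Lemma base_changeP (T : comAlgType S) (g : {rmorphism quartic_ring F -> T}) :
  (forall (a : R) x, g (a *: x) = f a *: g x) ->
  exists2 h : {lrmorphism quartic_ring (map_bqf f F) -> T},
    forall x, h (base_change x) = g x &
    forall h' : {lrmorphism quartic_ring (map_bqf f F) -> T},
      (forall x, h' (base_change x) = g x) -> h' =1 h.
Proof.
move=> gZ.
pose h (x : quartic_ring (map_bqf f F)) : T := \sum_i x 0 i *: g (qbasis F i).
have hD : zmod_morphism h.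
  move=> x y; rewrite /h -sumrB; apply: eq_bigr => i _.
  by rewrite !mxE scalerBl.
have hZ : scalable h.
  move=> a x; rewrite /h scaler_sumr; apply: eq_bigr => i _.
  by rewrite !mxE scalerA.
have hg x : h (base_change x) = g x.
  have dx : x = \sum_i x 0 i *: qbasis F i by exact: row_sum_delta.
  rewrite [in RHS]dx raddf_sum /h; apply: eq_bigr => i _.
  by rewrite /= gZ mxE.
have hdec (x : quartic_ring (map_bqf f F)) :
    x = \sum_i x 0 i *: base_change (qbasis F i).
  under eq_bigr => i _ do rewrite base_change_basis.
  exact: row_sum_delta.
pose hz := GRing.isZmodMorphism.Build _ _ h hD.
pose hs := GRing.isScalable.Build _ _ _ _ h hZ.
pose hL : {linear quartic_ring (map_bqf f F) -> T} := HB.pack h hz hs.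
have hsum (u : 'I_4 -> quartic_ring (map_bqf f F)) :
  h (\sum_i u i) = \sum_i h (u i) by exact: (raddf_sum hL).
have hM : monoid_morphism h.
  split; first by rewrite -(rmorph1 base_change) hg rmorph1.
  move=> x y; rewrite [x in LHS]hdec [y in LHS]hdec mulr_suml.
  rewrite hsum [h x in RHS]/h mulr_suml; apply: eq_bigr => i _.
  rewrite -scalerAl hZ -scalerAl; congr (_ *: _).
  rewrite mulr_sumr hsum [h y in RHS]/h mulr_sumr.
  apply: eq_bigr => j _.
  by rewrite -!scalerAr hZ -rmorphM /= hg rmorphM.
pose hm := GRing.isMonoidMorphism.Build _ _ h hM.
pose hR : {lrmorphism quartic_ring (map_bqf f F) -> T} := HB.pack h hz hs hm.
exists hR => [//|h' h'g x]; rewrite [x]hdec !linear_sum.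
by apply: eq_bigr => i _; rewrite !linearZ /= h'g hg.
Qed.

End BaseChange.

(** Z_p (x)_Z Q_F. *)
Definition padic_quartic_ring (p : nat) (F : bqf int) :
    comAlgType (padic_int p) :=
  quartic_ring (map_bqf (intr : int -> padic_int p) F).

Definition maximal_at (p : nat) (F : bqf int) : Prop :=
  maximal_quartic_ring (padic_quartic_ring p F).

(* Main.v *)
From HB Require Import structures.
Require Import Defs.
From mathcomp Require Import all_boot all_order all_algebra.
From mathcomp Require Import ring boolp.

(** Write [F = f(u, v)] with [u = x^2 + y^2], [v = x y] and
    [f = A u^2 + B u v + C v^2], so that [4 A + 2 B + C] and [4 A - 2 B + C] are the
    values of [F] at [(1, 1)] and [(-1, 1)] and [B^2 - 4 A C] is the discriminant of
    [f]. If a condition fails, then [F] is divisible by [p], or it has a root modulo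
    [p^2] that is double modulo [p], or it has the form [A g^2 + p b g v + p^2 c v^2]
    with [g = u + s v], and in each case an explicit lattice between [S] and
    [p^-1 S], where [S] is the ring of [F] over [Z_p], is a larger ring.

    Conversely, let [T] be a quartic ring containing [S], and let [I = p T :&: S].
    Then [I] is an ideal, its elements are nilpotent modulo [p] (Cayley-Hamilton in
    [T]), and [a b = p m] with [a], [b] in [I] forces [m] in [I]. Dividing products
    of elements of [I] by [p] in this way until a non-nilpotent element appears
    shows that [I = p S], hence [T = S]. For odd [p] the nilpotents modulo [p] are
    found from the splitting of [S] into the eigenspaces of the involution
    exchanging [x] and [y], for [p = 2] from the linearity of squaring modulo 2. *)

Set Implicit Arguments.
Unset Strict Implicit.
Unset Printing Implicit Defensive.

Import GRing.Theory.
Local Open Scope ring_scope.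

(** * The residue map of the p-adic integers *)

(** Together these say that [R] is local with residue field [k], its maximal ideal being generated
    by the non-zero-divisor [pi]. *)
Record residue_map (R : comNzRingType) (k : fieldType)
    (rho : {rmorphism R -> k}) (pi : R) : Prop := ResidueMap {
  residue_surj : forall a, exists x, rho x = a;
  residue_ker : forall x, rho x = 0 <-> exists y, x = pi * y;
  residue_unit : forall x, rho x != 0 -> exists y, x * y = 1;
  residue_reg : forall x, pi * x = 0 -> x = 0 }.

Section Padic.
Variables (p : nat) (p_pr : prime p).

Let p_gt1 : (1 < p)%N := prime_gt1 p_pr.

Let pX_gt1 n : (1 < p ^ n.+1)%N.
Proof. by rewrite -(exp1n n.+1) ltn_exp2r. Qed.

Lemma val_inZp_pX n m : val (inZp m : 'Z_(p ^ n.+1)) = (m %% p ^ n.+1)%N.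
Proof. by rewrite /=; congr (_ %% _)%N; apply: Zp_cast. Qed.

Lemma val_padic_natmul n (x : 'Z_(p ^ n.+1)) m :
  val (m%:R * x) = (m * val x %% p ^ n.+1)%N.
Proof.
by rewrite mulr_natl Zp_mulrn /= mulnC; congr (_ %% _)%N; apply: Zp_cast.
Qed.

Lemma val_padic_level (x : padic_int p) n : val (x n) = (val (x n.+1) %% p ^ n.+1)%N.
Proof. by rewrite -(padic_levelP x n) val_inZp_pX. Qed.

Lemma padic_natE (m n : nat) : (m%:R : padic_int p) n = m%:R.
Proof. by elim: m => [|m IHm] //; rewrite !mulrS /= IHm. Qed.

(** Level 0 already lives modulo [p ^ 1]; the passage through the representative only changes the
    type ['Z_(p ^ 1)] into ['F_p]. *)
Definition padic_res (x : padic_int p) : 'F_p := (val (x 0%N))%:R.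

Lemma padic_res_zmod_morphism : zmod_morphism padic_res.
Proof.
move=> x y; apply/eqP; rewrite eq_sym subr_eq; apply/eqP; rewrite /padic_res.
have -> : val (x 0%N) = ((val (x 0%N - y 0%N)%R + val (y 0%N)) %% p)%N.
  rewrite -[X in val X = _](subrK (y 0%N)) /=; congr (_ %% _)%N.
  by rewrite Zp_cast // expn1.
by rewrite Fp_nat_mod // natrD.
Qed.

Lemma padic_res_monoid_morphism : monoid_morphism padic_res.
Proof.
split=> [|x y]; rewrite /padic_res /=.
  by rewrite modn_small.
rewrite -natrM; have: (Zp_trunc (p ^ 1)).+2 = p by rewrite Zp_cast // expn1.
by move: (nat_of_ord _ * _)%N => m; move: (Zp_trunc _).+2 => _ ->; rewrite Fp_nat_mod.
Qed.

HB.instance Definition _ := GRing.isZmodMorphism.Build _ _ padic_res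
  padic_res_zmod_morphism.
HB.instance Definition _ := GRing.isMonoidMorphism.Build _ _ padic_res
  padic_res_monoid_morphism.

Lemma padic_res_ker (x : padic_int p) :
  padic_res x = 0 <-> exists y, x = p%:R * y.
Proof.
split=> [x0|[y ->]]; last first.
  by rewrite rmorphM rmorph_nat pchar_Fp_0 // mul0r.
have pdvd n : (p %| val (x n))%N.
  elim: n => [|n]; last first.
    by rewrite val_padic_level /dvdn modn_dvdm // dvdn_exp.
  by rewrite (dvdn_pcharf (pchar_Fp p_pr)); apply/eqP.
(* Division by [p] costs one level: a multiple of [p] modulo [p ^ n.+2] has a quotient defined
   modulo [p ^ n.+1]. *)
pose y n : 'Z_(p ^ n.+1) := inZp (val (x n.+1) %/ p).
have yP n : padic_red (y n.+1) = y n.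
  apply: val_inj; rewrite /padic_red !val_inZp_pX [in RHS](val_padic_level x n.+1).
  rewrite modn_dvdm ?dvdn_exp2l //.
  move: (val (x n.+2)) => m.
  rewrite [in LHS](divn_eq m (p ^ n.+2)) [X in (_ * X + _)%N]expnSr mulnA.
  by rewrite divnMDl ?prime_gt0 // modnMDl.
exists (PadicInt yP); apply: padic_intP => n; apply: val_inj.
rewrite [RHS]/= -/(val _) -[RHS]/(val ((p%:R : padic_int p) n * y n)) padic_natE.
rewrite val_padic_natmul val_inZp_pX modnMmr mulnC divnK //.
exact: val_padic_level.
Qed.

(** At level [n.+1] the hypothesis makes [x n.+1] a multiple of [p ^ n.+1], which kills level
    [n]. *)
Lemma padic_reg (x : padic_int p) : p%:R * x = 0 -> x = 0.
Proof.
move=> px0; apply: padic_intP => n; apply: val_inj.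
have : val ((p%:R * x) n.+1) = 0%N by rewrite px0.
rewrite -[X in val X]/((p%:R : padic_int p) n.+1 * x n.+1) padic_natE.
rewrite val_padic_natmul [val (x n)]val_padic_level.
move: (val (x n.+1)) => m /eqP.
by rewrite -/(_ %| _)%N expnS dvdn_pmul2l ?prime_gt0 // => /eqP.
Qed.

Lemma padic_unit (x : padic_int p) : padic_res x != 0 -> exists y, x * y = 1.
Proof.
rewrite /padic_res -(dvdn_pcharf (pchar_Fp p_pr)) => ndvd.
have xU n : x n \is a GRing.unit.
  rewrite -(natr_Zp (x n)) unitZpE // coprime_pexpl // prime_coprime //.
  apply: contra ndvd; elim: n => [//|n IHn pn]; apply: IHn.
  by rewrite [nat_of_ord _]val_padic_level /dvdn modn_dvdm // dvdn_exp.
pose y n := (x n)^-1.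
have yP n : padic_red (y n.+1) = y n.
  apply: (mulrI (xU n)); rewrite [RHS](divrr (xU n)).
  have := padic_redM (x n.+1) (y n.+1).
  rewrite [x _ * _](divrr (xU n.+1)) => e; rewrite -[in LHS](padic_levelP x n).
  by apply: etrans (esym e) _; apply: (padic_red1 p n).
by exists (PadicInt yP); apply: padic_intP => n; apply: divrr (xU n).
Qed.

Definition padic_rho : {rmorphism padic_int p -> 'F_p} := padic_res.

Lemma padic_residue_map : residue_map padic_rho p%:R.
Proof.
split=> [a|||]; [|exact: padic_res_ker|exact: padic_unit|exact: padic_reg].
by exists (val a)%:R; rewrite rmorph_nat natr_Zp.
Qed.

Lemma padic_rho_int (z : int) : (padic_rho z%:~R == 0) = (p %| z)%Z.
Proof. by rewrite rmorph_int -(dvdz_pcharf (pchar_Fp p_pr)). Qed.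

End Padic.

(** * Rings between a quartic ring and a multiple of it *)

Section OverLattice.
Variables (R : comNzRingType) (S : comAlgType R) (pi : R).

Definition lattice (b : 'I_4 -> S) (c : 'rV[R]_4) : S := \sum_i c 0 i *: b i.

Lemma lattice_is_zmod_morphism b : zmod_morphism (lattice b).
Proof.
move=> x y; rewrite /lattice -sumrB; apply: eq_bigr => i _.
by rewrite !mxE scalerBl.
Qed.

Lemma lattice_is_scalable b : scalable (lattice b).
Proof.
move=> a x; rewrite /lattice scaler_sumr; apply: eq_bigr => i _.
by rewrite !mxE scalerA.
Qed.

HB.instance Definition _ b := GRing.isZmodMorphism.Build _ _ (lattice b)
  (lattice_is_zmod_morphism b).
HB.instance Definition _ b := GRing.isScalable.Build R _ _ _ (lattice b)
  (lattice_is_scalable b).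

Lemma lattice_delta b i : lattice b (delta_mx 0 i) = b i.
Proof.
rewrite /lattice (bigD1 i) //= big1 ?addr0 => [|j ji].
  by rewrite mxE !eqxx scale1r.
by rewrite mxE (negPf ji) andbF scale0r.
Qed.

Record over_lattice := OverLattice {
  ol_basis : 'I_4 -> S;
  ol_reg : forall s : S, pi *: s = 0 -> s = 0;
  ol_free : forall c, lattice ol_basis c = 0 -> c = 0;
  ol_pi : forall s, exists c, pi *: s = lattice ol_basis c;
  ol_mul : forall i j, exists c,
    ol_basis i * ol_basis j = pi *: lattice ol_basis c }.

End OverLattice.

(** The ring [pi^-1 L] for a lattice [L] with [pi S <= L] and [L L <= pi L]; the
    coordinates are those of [pi x] in the basis of [L]. *)
Definition over_ring (R : comNzRingType) (S : comAlgType R) (pi : R)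
  (L : over_lattice S pi) : Type :=
  'rV[R]_4.

Section OverRing.
Variables (R : comNzRingType) (S : comAlgType R) (pi : R) (L : over_lattice S pi).
Local Notation T := (over_ring L).
Local Notation lat := (lattice (ol_basis L)).

HB.instance Definition _ := GRing.Lmodule.copy T 'rV[R]_4.

Lemma lat_inj (x y : T) : lat x = lat y -> x = y.
Proof.
by move=> /eqP; rewrite -subr_eq0 -raddfB => /eqP /ol_free /eqP; rewrite subr_eq0 => /eqP.
Qed.

Lemma pi_inj (s t : S) : pi *: s = pi *: t -> s = t.
Proof.
by move=> /eqP; rewrite -subr_eq0 -scalerBr => /eqP /(ol_reg L) /eqP; rewrite subr_eq0 => /eqP.
Qed.

Lemma over_mul_ex (x y : T) : exists z : T, lat x * lat y = pi *: lat z.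
Proof.
have [c cP] : exists c : 'I_4 -> 'I_4 -> 'rV[R]_4,
    forall i j, ol_basis L i * ol_basis L j = pi *: lat (c i j).
  exists (fun i j => sval (cid (ol_mul L i j))) => i j.
  by case: (cid _).
exists (\sum_i \sum_j (x 0 i * y 0 j) *: c i j).
pose l : {linear 'rV[R]_4 -> S} := lattice (ol_basis L).
rewrite -[lat (\sum_i _)]/(l _) (linear_sum l) scaler_sumr mulr_suml.
apply: eq_bigr => i _; rewrite (linear_sum l) scaler_sumr mulr_sumr.
apply: eq_bigr => j _.
by rewrite -scalerAl -scalerAr scalerA cP /l /= lattice_is_scalable !scalerA mulrC.
Qed.

Definition over_mul (x y : T) : T := sval (cid (over_mul_ex x y)).

Lemma over_mulE x y : pi *: lat (over_mul x y) = lat x * lat y.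
Proof. by rewrite /over_mul; case: (cid _). Qed.

Definition over_in (s : S) : T := sval (cid (ol_pi L s)).

Lemma over_inE s : lat (over_in s) = pi *: s.
Proof. by rewrite /over_in; case: (cid _). Qed.

Lemma over_mulA : associative over_mul.
Proof.
move=> x y z; apply/lat_inj/pi_inj/pi_inj.
by rewrite !over_mulE scalerAr scalerAl !over_mulE mulrA.
Qed.

Lemma over_mulC : commutative over_mul.
Proof. by move=> x y; apply/lat_inj/pi_inj; rewrite !over_mulE mulrC. Qed.

Lemma over_mul1 : left_id (over_in 1) over_mul.
Proof.
by move=> x; apply/lat_inj/pi_inj; rewrite over_mulE over_inE -scalerAl mul1r.
Qed.

Lemma over_mulD : left_distributive over_mul +%R.
Proof.
move=> x y z; apply/lat_inj/pi_inj.
by rewrite raddfD scalerDr !over_mulE raddfD mulrDl.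
Qed.

Lemma over_one_neq0 : over_in 1 != 0.
Proof.
apply/eqP => e; have := over_inE 1; rewrite e raddf0 => /esym /(ol_reg L) /eqP.
by rewrite oner_eq0.
Qed.

HB.instance Definition _ := GRing.Zmodule_isComNzRing.Build T
  over_mulA over_mulC over_mul1 over_mulD over_one_neq0.

Lemma over_scaleAl (a : R) (x y : T) : a *: (x * y) = (a *: x) * y.
Proof.
apply/lat_inj/pi_inj; rewrite over_mulE !lattice_is_scalable scalerA mulrC -scalerA.
by rewrite over_mulE -scalerAl.
Qed.

HB.instance Definition _ := GRing.Lmodule_isLalgebra.Build R T over_scaleAl.
HB.instance Definition _ := GRing.Lalgebra_isComAlgebra.Build R T.

Lemma over_in_is_zmod_morphism : zmod_morphism over_in.
Proof. by move=> x y; apply: lat_inj; rewrite lattice_is_zmod_morphism !over_inE scalerBr. Qed.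

Lemma over_in_is_scalable : scalable over_in.
Proof.
move=> a x; apply: lat_inj.
by rewrite over_inE lattice_is_scalable over_inE !scalerA mulrC.
Qed.

Lemma over_in_is_monoid_morphism : monoid_morphism over_in.
Proof.
split=> // x y; apply/lat_inj/pi_inj.
by rewrite over_mulE !over_inE -scalerAl -scalerAr.
Qed.

HB.instance Definition _ := GRing.isZmodMorphism.Build _ _ over_in
  over_in_is_zmod_morphism.
HB.instance Definition _ := GRing.isScalable.Build R _ _ _ over_in
  over_in_is_scalable.
HB.instance Definition _ := GRing.isMonoidMorphism.Build _ _ over_in
  over_in_is_monoid_morphism.

Lemma over_ring_quartic : is_quartic_ring T.
Proof.
exists (fun i => delta_mx 0 i : T) => s; exists s; split; first exact: row_sum_delta.
by move=> c ->; rewrite [RHS]row_sum_delta.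
Qed.

(** A basis vector outside [pi S], divided by [pi], is an element of the larger ring outside [S]. *)
Lemma over_lattice_not_maximal i :
  (forall s, ol_basis L i <> pi *: s) -> ~ maximal_quartic_ring S.
Proof.
move=> bi [_ /(_ T over_in over_ring_quartic)] surj.
case: (surj _ (delta_mx 0 i)) => [x y e|s es].
  by apply: pi_inj; rewrite -!over_inE e.
by apply: (bi s); rewrite -over_inE es lattice_delta.
Qed.

End OverRing.

(** * Explicit enlargements of the ring of a form *)

Section Lattices.
Variables (R : comNzRingType) (pi : R).
Hypotheses (pi_reg : forall x, pi * x = 0 -> x = 0).
Hypotheses (pi_nunit : forall x, pi * x <> 1).

Definition basis4 (T : Type) (b0 b1 b2 b3 : T) (i : 'I_4) : T :=
  nth b0 [:: b0; b1; b2; b3] i.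

Lemma lattice_basis4 (S : comAlgType R) (b0 b1 b2 b3 : S) (c : 'rV[R]_4) :
  lattice (basis4 b0 b1 b2 b3) c =
  c 0 (inord 0) *: b0 + c 0 (inord 1) *: b1 + c 0 (inord 2) *: b2 + c 0 (inord 3) *: b3.
Proof.
rewrite /lattice !big_ord_recl big_ord0 addr0 !addrA /basis4 /=.
by congr (_ *: _ + _ *: _ + _ *: _ + _ *: _); apply: (congr1 (c 0));
  apply: val_inj; rewrite /= inordK.
Qed.

Definition in_span (F : bqf R) (b0 b1 b2 b3 x : quartic_ring F) : Prop := exists c0 c1 c2 c3 : R,
  x = c0 *: b0 + c1 *: b1 + c2 *: b2 + c3 *: b3.

(** Products with [b0 = pi *: 1] lie in [pi L] for free, which leaves six products to check; the
    last coordinate 1 of [b3] keeps it out of [pi S]. *)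
Lemma not_maximal_lattice (F : bqf R) (b1 b2 b3 : quartic_ring F) :
  let b0 : quartic_ring F := pi *: 1 in let inL := in_span b0 b1 b2 b3 in
  (forall c0 c1 c2 c3 : R, c0 *: b0 + c1 *: b1 + c2 *: b2 + c3 *: b3 = 0 ->
     [/\ c0 = 0, c1 = 0, c2 = 0 & c3 = 0]) ->
  (forall s, inL (pi *: s)) ->
  (exists2 z, inL z & b1 * b1 = pi *: z) ->
  (exists2 z, inL z & b1 * b2 = pi *: z) ->
  (exists2 z, inL z & b1 * b3 = pi *: z) ->
  (exists2 z, inL z & b2 * b2 = pi *: z) ->
  (exists2 z, inL z & b2 * b3 = pi *: z) ->
  (exists2 z, inL z & b3 * b3 = pi *: z) ->
  b3 0 (inord 3) = 1 ->
  ~ maximal_quartic_ring (quartic_ring F).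
Proof.
move=> b0 inL free pi_in h11 h12 h13 h22 h23 h33 b3_1.
pose b := basis4 b0 b1 b2 b3.
have spanP x : inL x -> exists c, x = lattice b c.
  case=> [c0 [c1 [c2 [c3 ->]]]]; exists (row4 c0 c1 c2 c3).
  by rewrite lattice_basis4 !row4E.
have mulP x y : (exists2 z, inL z & x * y = pi *: z) ->
    exists c, x * y = pi *: lattice b c.
  by case=> z /spanP [c ->] ->; exists c.
have mulC x y : (exists2 z, inL z & y * x = pi *: z) ->
    exists c, x * y = pi *: lattice b c.
  by rewrite mulrC; apply: mulP.
have L0 x : inL x -> exists2 z, inL z & b0 * x = pi *: z.
  by move=> Lx; exists x => //; rewrite -scalerAl mul1r.
have [Lb0 Lb1 Lb2 Lb3] : [/\ inL b0, inL b1, inL b2 & inL b3].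
  by split; [exists 1, 0, 0, 0|exists 0, 1, 0, 0|exists 0, 0, 1, 0|exists 0, 0, 0, 1];
    rewrite !scale0r !scale1r ?add0r ?addr0.
have reg (s : quartic_ring F) : pi *: s = 0 -> s = 0.
  move=> ps; apply/rowP => i; rewrite [RHS]mxE; apply: pi_reg.
  by have /rowP /(_ i) := ps; rewrite !mxE.
have free' c : lattice b c = 0 -> c = 0.
  rewrite lattice_basis4 => /free [c0 c1 c2 c3].
  by apply: row4P; rewrite mxE.
have mul' i j : exists c, b i * b j = pi *: lattice b c.
  case: i j => [[|[|[|[|i]]]] lti] [[|[|[|[|j]]]] ltj] //; rewrite /b /basis4 /=;
  by [apply: mulP => //; apply: L0|apply: mulC => //; apply: L0].
apply: (@over_lattice_not_maximal _ _ _
  (OverLattice reg free' (fun s => spanP _ (pi_in s)) mul') ord_max) => s /=.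
rewrite /b /basis4 /= => /(congr1 (fun x : 'rV[R]_4 => x 0 (inord 3))).
by rewrite b3_1 mxE => /esym; apply: pi_nunit.
Qed.

Lemma row4_eq0 (x : 'rV[R]_4) : x = 0 ->
  [/\ x 0 (inord 0) = 0, x 0 (inord 1) = 0, x 0 (inord 2) = 0 & x 0 (inord 3) = 0].
Proof. by move->; rewrite !mxE. Qed.

Ltac row_ring := apply: row4P; rewrite ?qmulE /qmul /= !(row4E, mxE) /=; ring.
Ltac in_lattice c0 c1 c2 c3 :=
  eexists; [exists c0, c1, c2, c3; reflexivity|row_ring].

(** The larger ring is that of [f], whose w1, w2, w3 are those of [pi f] divided by [pi]. *)
Lemma not_maximal_content (f : bqf R) :
  ~ maximal_quartic_ring (quartic_ring (map_bqf ( *%R pi) f)).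
Proof.
case: f => f4 f3 f2 f1 f0; rewrite /map_bqf /=.
set F := BQF _ _ _ _ _.
apply: (@not_maximal_lattice F (row4 0 1 0 0) (row4 0 0 1 0) (row4 0 0 0 1)).
- move=> c0 c1 c2 c3 /row4_eq0; rewrite !(row4E, mxE) /=.
  rewrite !(mulr0, mulr1, addr0, add0r) => -[e0 -> -> ->]; split=> //.
  by apply: pi_reg; rewrite mulrC.
- move=> s; exists (s 0 (inord 0)), (pi * s 0 (inord 1)), (pi * s 0 (inord 2)),
    (pi * s 0 (inord 3)); row_ring.
- in_lattice (0 : R) (- f3) f4 (0 : R).
- in_lattice (0 : R) (- f2) (0 : R) f4.
- in_lattice (- (f0 * f4)) (- f1) (0 : R) (0 : R).
- in_lattice (- (f0 * f4)) (- f1) (- f2) f3.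
- in_lattice (- (f0 * f3)) (- f0) (- f1) (0 : R).
- in_lattice (- (f0 * f2)) (0 : R) (- f0) (- f1).
- by rewrite row4E.
Qed.

(** Moving the root [r] to 0 makes the coefficient a0 divisible by [pi ^+ 2] and a1 by [pi]. The
    products w1 w3 and w2 w3 are then divisible by [pi], and w3 w3 = - a0 a2 - a0 w2 - a1 w3, so w3
    / pi can be adjoined. *)
Lemma not_maximal_double_root (a4 a3 a2 a1 a0 r u v : R) :
  a4 * r ^+ 4 + a3 * r ^+ 3 + a2 * r ^+ 2 + a1 * r + a0 = pi ^+ 2 * u ->
  4 * a4 * r ^+ 3 + 3 * a3 * r ^+ 2 + 2 * a2 * r + a1 = pi * v ->
  ~ maximal_quartic_ring (quartic_ring (BQF a4 a3 a2 a1 a0)).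
Proof.
move=> e0 e1.
have {}e1 : a1 = pi * v - (4 * a4 * r ^+ 3 + 3 * a3 * r ^+ 2 + 2 * a2 * r).
  by rewrite -e1; ring.
have {}e0 : a0 = pi ^+ 2 * u - (a4 * r ^+ 4 + a3 * r ^+ 3 + a2 * r ^+ 2 + a1 * r).
  by rewrite -e0; ring.
rewrite e0 e1 {e0 e1}; set F := BQF _ _ _ _ _.
pose k := - (a2 * r + 2 * a3 * r ^+ 2 + 3 * a4 * r ^+ 3).
(* [row4 k (r ^+ 2) r 1] is w3' for the translated form F(x + r y, y). *)
apply: (@not_maximal_lattice F (row4 0 pi 0 0) (row4 0 0 pi 0) (row4 k (r ^+ 2) r 1)).
- move=> c0 c1 c2 c3 /row4_eq0; rewrite !(row4E, mxE) /=.
  rewrite !(mulr0, mulr1, addr0, add0r) => -[e0 e1 e2 e3].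
  move: e0 e1 e2; rewrite e3 !(mul0r, addr0) => e0 e1 e2.
  by split=> //; apply: pi_reg; rewrite mulrC.
- move=> s; exists (s 0 (inord 0) - k * s 0 (inord 3)),
    (s 0 (inord 1) - r ^+ 2 * s 0 (inord 3)), (s 0 (inord 2) - r * s 0 (inord 3)),
    (pi * s 0 (inord 3)); row_ring.
- in_lattice (0 : R) (- a3) a4 (0 : R).
- in_lattice (- (a4 * k)) (- (a2 + a4 * r ^+ 2)) (- (a4 * r)) (a4 * pi).
- rewrite /k; in_lattice (v * r * a4 - pi * u * a4) (- v) (0 : R) (r * a4).
- in_lattice (- (Defs.a0 F * a4) - a3 * k) (- (Defs.a1 F + a3 * r ^+ 2))
    (- (a2 + a3 * r)) (a3 * pi).
- rewrite /k; in_lattice (- (pi * u * (4 * a4 * r + a3)) + 3 * pi * u * r * a4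
      + v * (a4 * r ^+ 2 + a3 * r))
    (- (pi * u)) (- v) (a4 * r ^+ 2 + a3 * r).
- rewrite /k; in_lattice (- u * (3 * a4 * r ^+ 2 + 2 * a3 * r + a2)) (- (2 * r * u)) (- u) (- v).
- by rewrite row4E.
Qed.

(** For a root t and h = (t^2 + s t + 1) / pi, the equation divided by pi^2 reads a h^2 + b h t + c
    t^2 = 0. This suggests adjoining a h + b t and t (a h + b t). *)
Lemma not_maximal_square (a s b c : R) :
  let a3 := 2 * a * s + pi * b in
  let a2 := a * (s ^+ 2 + 2) + pi * b * s + pi ^+ 2 * c in
  ~ maximal_quartic_ring (quartic_ring (BQF a a3 a2 a3 a)).
Proof.
rewrite /=; set F := BQF _ _ _ _ _.
(* With [t] a root and [g = t^2 + s t + 1], the last two are [a g + pi b t] and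
   [t (a g + pi b t) + pi^2 c t]. *)
apply: (@not_maximal_lattice F (row4 0 pi 0 0) (row4 a (- s) 1 0)
  (row4 0 (s ^+ 2 - 1) (- s) 1)).
- move=> c0 c1 c2 c3 /row4_eq0; rewrite !(row4E, mxE) /=.
  rewrite !(mulr0, mulr1, addr0, add0r) => -[e0 e1 e2 e3].
  move: e2; rewrite e3 !(mul0r, addr0) => e2.
  move: e0 e1; rewrite e2 e3 !(mul0r, addr0) => e0 e1.
  by split=> //; apply: pi_reg; rewrite mulrC.
- move=> x; pose x1 := x 0 (inord 1); pose x2 := x 0 (inord 2); pose x3 := x 0 (inord 3).
  exists (x 0 (inord 0) - a * (x2 + s * x3)),
    (x1 + s * (x2 + s * x3) - (s ^+ 2 - 1) * x3), (pi * (x2 + s * x3)), (pi * x3).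
  rewrite /x1 /x2 /x3; row_ring.
- in_lattice (- a ^+ 2) (- (a * s) - pi * b) (a * pi) (0 : R).
- in_lattice (0 : R) (- (pi * c)) (0 : R) a.
- in_lattice (0 : R) (pi * c * s) (- a) (- (a * s)).
- in_lattice (c * a) (c * s) (- (pi * c)) b.
- in_lattice (- (c * s * a)) (c * (1 - s ^+ 2)) (pi * c * s - b) (- (b * s)).
- in_lattice (c * s ^+ 2 * a - c * a) (- (c * s * (1 - s ^+ 2)) - c * s)
    (b * s - pi * c * s ^+ 2) (b * s ^+ 2 - b).
- by rewrite row4E.
Qed.

End Lattices.

(** * A criterion for maximality *)

Section Saturated.
Variables (R : comNzRingType) (k : fieldType) (rho : {rmorphism R -> k}) (pi : R).
Hypothesis rm : residue_map rho pi.

Lemma residue_pi : rho pi = 0.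
Proof. by apply/(residue_ker rm); exists 1; rewrite mulr1. Qed.

Lemma residue_mx_ker m n (A : 'M[R]_(m, n)) :
  map_mx rho A = 0 -> exists B, A = pi *: B.
Proof.
move=> /matrixP A0.
have Bex i j : exists y, A i j = pi * y.
  by apply/(residue_ker rm); have := A0 i j; rewrite !mxE.
exists (\matrix_(i, j) sval (cid (Bex i j))); apply/matrixP => i j; rewrite !mxE.
by case: (cid _).
Qed.

Variable F : bqf R.
Local Notation S := (quartic_ring F).
Local Notation red := (@base_change _ _ rho F).

(** The properties of [pi T :&: S] for a quartic ring [T] containing [S]. *)
Record saturated (I : S -> Prop) : Prop := Saturated {
  sat_add : forall a b, I a -> I b -> I (a + b);
  sat_mul : forall (a b : S), I b -> I (a * b);
  sat_pi : forall (a : S), I (pi *: a);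
  sat_div : forall a b (m : S), I a -> I b -> a * b = pi *: m -> I m;
  sat_nil : forall a, I a -> exists n, red a ^+ n = 0 }.

Lemma red_scale a (x : S) : red (a *: x) = rho a *: red x.
Proof. exact: base_change_scale. Qed.

(** Since [I] contains [pi S], membership depends only on the class modulo [pi]; explicit members of
    [I] are found this way below. *)
Lemma sat_red (I : S -> Prop) a b : saturated I -> red a = red b -> I a -> I b.
Proof.
move=> sI eab Ia; have [m bm] : exists m : S, b - a = pi *: m.
  by apply: residue_mx_ker; rewrite -[LHS]/(red (b - a)) rmorphB /= eab subrr.
by rewrite -[b](subrK a) bm; apply: (sat_add sI) Ia; apply: (sat_pi sI).
Qed.

(** * The saturated ideal attached to a larger ring *)

Section Over.
Variables (T : comAlgType R) (f : {lrmorphism S -> T}).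
Hypotheses (f_inj : injective f).
Variable (b : 'I_4 -> T).
Hypothesis bP : forall t : T, exists! c : 'rV[R]_4, t = lattice b c.

Let bex t : exists c, t = lattice b c.
Proof. by have [c [cP _]] := bP t; exists c. Qed.

Let lat_inj' c d : lattice b c = lattice b d -> c = d.
Proof. by have [c' [_ u]] := bP (lattice b c) => e; rewrite -(u c) // (u d). Qed.

Lemma over_reg (s t : T) : pi *: s = pi *: t -> s = t.
Proof.
have [c ->] := bex s; have [d ->] := bex t.
rewrite -!lattice_is_scalable => /lat_inj' /rowP e; congr lattice.
apply/rowP => i; apply/eqP; rewrite -subr_eq0; apply/eqP/(residue_reg rm).
by have := e i; rewrite !mxE mulrBr => ->; rewrite subrr.
Qed.

Lemma over_integral (t : T) : exists c : 'I_4 -> R,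
  t ^+ 4 = \sum_(i < 4) c i *: t ^+ i.
Proof.
(* Row [i] holds the coordinates of [b i * t], so right multiplication by [M] on coordinates is
   multiplication by [t]; the Cayley-Hamilton relation is then applied to the coordinates [v] of
   1. *)
pose M : 'M[R]_4 := \matrix_i sval (cid (bex (b i * t))).
have MP v : lattice b (v *m M) = lattice b v * t.
  rewrite mulmx_sum_row -[LHS]/((lattice b : {linear _ -> _}) _) linear_sum mulr_suml.
  apply: eq_bigr => i _; rewrite linearZ /= -scalerAl rowK.
  by case: (cid _) => /= c <-.
have MX v n : lattice b (v *m M ^+ n) = lattice b v * t ^+ n.
  elim: n v => [|n IHn] v; first by rewrite !expr0 mulmx1 mulr1.
  by rewrite exprS mulmxA IHn MP exprS mulrA.
have [v v1] := bex 1.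
have := Cayley_Hamilton M; set p := char_poly M => p0.
have sp : size p = 5%N by rewrite size_char_poly.
have lp : p`_4 = 1.
  by have /monicP := char_poly_monic M; rewrite /lead_coef -/p sp.
have {}p0 : \sum_(i < 5) p`_i *: M ^+ i = 0.
  transitivity (horner_mx M (\sum_(i < 5) p`_i *: 'X^i)); last first.
    by rewrite -poly_def -sp coefK.
  rewrite [RHS]linear_sum /=; apply: eq_bigr => i _.
  by rewrite [RHS]linearZ /= rmorphXn /= horner_mx_X.
exists (fun i => - p`_i); apply/eqP; rewrite -subr_eq0 -sumrN.
have : lattice b (v *m \sum_(i < 5) p`_i *: M ^+ i) = 0.
  by rewrite p0 mulmx0 -[LHS]/((lattice b : {linear _ -> _}) _) linear0.
rewrite mulmx_sumr -[X in X = _]/((lattice b : {linear _ -> _}) _) linear_sum.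
rewrite big_ord_recr /= lp scale1r MX -v1 mul1r addrC => {2}<-.
apply/eqP; congr (_ + _); apply: eq_bigr => i _.
by rewrite -scalemxAr lattice_is_scalable MX -v1 mul1r scaleNr opprK.
Qed.

Lemma over_saturated : saturated (fun s => exists t, f s = pi *: t).
Proof.
split.
- by move=> x y [t et] [u eu]; exists (t + u); rewrite rmorphD /= et eu scalerDr.
- by move=> x y [t et]; exists (f x * t); rewrite rmorphM /= et scalerAr.
- by move=> x; exists (f x); rewrite linearZ.
- move=> x y m [t et] [u eu] e; exists (t * u); apply: over_reg.
  by rewrite -[LHS]linearZ -e rmorphM /= et eu -scalerAl -scalerAr.
move=> x [t et]; exists 4%N.
have [c e] := over_integral t.
(* With [f x = pi *: t], the degree 4 relation for [t] times [pi ^+ 4] expresses [x ^+ 4] with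
   coefficients [c i * pi ^+ (4 - i)]; as [i <= 3], one factor [pi] comes out. *)
pose m : S := \sum_(i < 4) (c i * pi ^+ (3 - i)) *: x ^+ i.
rewrite -rmorphXn; suff -> : x ^+ 4 = pi *: m.
  by rewrite /= red_scale residue_pi scale0r.
have fm : f m = \sum_(i < 4) (c i * pi ^+ (3 - i)) *: f x ^+ i.
  by rewrite linear_sum; apply: eq_bigr => i _; rewrite linearZ /= rmorphXn.
apply: f_inj; rewrite linearZ /= rmorphXn /= fm et exprZn e !scaler_sumr.
apply: eq_bigr => i _; rewrite exprZn !scalerA; congr (_ *: _).
have i_le3 : (i <= 3)%N by rewrite -ltnS ltn_ord.
have -> : pi ^+ 4 = pi * (pi ^+ (3 - i) * pi ^+ i).
  by rewrite -exprD subnK // -exprS.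
by ring.
Qed.

(** If the determinant of [f] vanished modulo [pi], a nonzero kernel vector modulo [pi] would lift
    to some [s] with [f s] in [pi T], against the hypothesis. So the determinant is a unit and the
    adjugate inverts [f]. *)
Lemma over_surjective :
  (forall s, (exists t, f s = pi *: t) -> red s = 0) -> forall t, exists s, f s = t.
Proof.
move=> f0 t.
pose A : 'M[R]_4 := \matrix_i sval (cid (bex (f (qbasis F i)))).
have AP s : f s = lattice b (s *m A).
  rewrite [s in LHS](row_sum_delta s) linear_sum mulmx_sum_row.
  rewrite -[RHS]/((lattice b : {linear _ -> _}) _) linear_sum.
  apply: eq_bigr => i _; rewrite !linearZ /= rowK.
  by case: (cid _) => /= c <-.
have : rho (\det A) != 0.
  rewrite -det_map_mx; apply/negP => /det0P [v /eqP nzv vA]; apply: nzv.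
  have vex i : exists x, rho x = v 0 i by apply: (residue_surj rm).
  pose s : S := \row_i sval (cid (vex i)).
  have sv : map_mx rho s = v.
    by apply/rowP => i; rewrite !mxE; case: (cid _).
  rewrite -sv; apply: f0.
  have [|w sA] := @residue_mx_ker _ _ (s *m A); first by rewrite map_mxM sv.
  by exists (lattice b w); rewrite (AP s) sA lattice_is_scalable.
case/(residue_unit rm) => y Ay; have [c ->] := bex t.
exists (y *: (c *m \adj A)); rewrite AP -scalemxAl -mulmxA mul_adj_mx.
by rewrite mul_mx_scalar scalerA mulrC Ay scale1r.
Qed.

End Over.

Lemma maximal_saturated :
  (forall I, saturated I -> forall a, I a -> red a = 0) -> maximal_quartic_ring S.
Proof.
move=> H; split; first exact: quartic_ringP.
move=> T f [b bP] f_inj; apply: (over_surjective bP).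
by apply: H; apply: (over_saturated f_inj bP).
Qed.

End Saturated.

(** * Odd primes *)

Section Nilpotent.
Variable R : comNzRingType.

Definition nilp (x : R) : Prop := exists n, x ^+ n = 0.

Lemma nilpM x y : nilp y -> nilp (x * y).
Proof. by case=> n yn; exists n; rewrite exprMn yn mulr0. Qed.

Lemma nilpD x y : nilp x -> nilp y -> nilp (x + y).
Proof.
case=> n xn [m ym]; exists (n + m)%N; rewrite exprDn big1 // => i _.
have [le_mi | lt_im] := leqP m i.
  by rewrite -(subnK le_mi) [y ^+ _]exprD ym !mulr0 mul0rn.
by rewrite -addnBA ?(ltnW lt_im) // exprD xn !mul0r mul0rn.
Qed.

(** This and the next two lemmas derive an equation from known ones by explicit cofactors, leaving
    an identity to [ring]. *)
Lemma eq0_lincomb1 (q l r t : R) : l = r -> t = q * (l - r) -> t = 0.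
Proof. by move=> -> ->; rewrite subrr mulr0. Qed.

Lemma eq0_lincomb2 (q1 q2 l1 r1 l2 r2 t : R) : l1 = r1 -> l2 = r2 ->
  t = q1 * (l1 - r1) + q2 * (l2 - r2) -> t = 0.
Proof. by move=> -> -> ->; rewrite !subrr !mulr0 addr0. Qed.

Lemma eq0_lincomb3 (q1 q2 q3 l1 r1 l2 r2 l3 r3 t : R) : l1 = r1 -> l2 = r2 -> l3 = r3 ->
  t = q1 * (l1 - r1) + q2 * (l2 - r2) + q3 * (l3 - r3) -> t = 0.
Proof. by move=> -> -> -> ->; rewrite !subrr !mulr0 !addr0. Qed.

End Nilpotent.

Arguments eq0_lincomb1 {R} q {l r t}.
Arguments eq0_lincomb2 {R} q1 q2 {l1 r1 l2 r2 t}.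
Arguments eq0_lincomb3 {R} q1 q2 q3 {l1 r1 l2 r2 l3 r3 t}.

(** * Palindromic forms and the involution t -> 1/t *)

Section Palindromic.
Variable R : comNzRingType.
Implicit Types A B C : R.

Definition palin A B C : bqf R := BQF A B (C + 2 * A) B A.

(** [x0 + x1 al + y be + z ga] with [al = w1 - w3 - B], [be = w1 + w3 + B] and
    [ga = 2 w2 + C + 2 A]. The involution [t |-> 1/t] fixes [al] and negates
    [be] and [ga]; [(x0, x1)] and [(y, z)] are the even and odd parts. *)
Definition eo A B C (x0 x1 y z : R) : 'rV[R]_4 :=
  row4 (x0 - B * x1 + B * y + (C + 2 * A) * z) (x1 + y) (2 * z) (y - x1).

(** The product respects parity. The even elements form the quadratic ring of [al], with al^2 + B al
    + A C = 0, whose discriminant is B^2 - 4 A C. *)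
Lemma eoM A B C x0 x1 y z x0' x1' y' z' :
  (eo A B C x0 x1 y z : quartic_ring (palin A B C)) * eo A B C x0' x1' y' z' =
  eo A B C
    (x0 * x0' - A * C * x1 * x1' - A * (C + 4 * A) * y * y'
       - 4 * A * B * (y * z' + z * y') + (C ^+ 2 + 4 * A * C - 4 * B ^+ 2) * z * z')
    (x0 * x1' + x1 * x0' - B * x1 * x1' - B * y * y' - (C + 4 * A) * (y * z' + z * y')
       - 4 * B * z * z')
    (x0 * y' - B * x1 * y' - C * x1 * z' + x0' * y - B * x1' * y - C * x1' * z)
    (x0 * z' + A * x1 * y' + x0' * z + A * x1' * y).
Proof. by rewrite /eo; apply: row4P; rewrite qmulE /qmul !row4E /=; ring. Qed.

Lemma eoZ A B C x0 x1 y z a :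
  a *: eo A B C x0 x1 y z = eo A B C (a * x0) (a * x1) (a * y) (a * z).
Proof. by rewrite /eo; apply: row4P; rewrite mxE !row4E; ring. Qed.

Lemma eoD A B C x0 x1 y z x0' x1' y' z' :
  eo A B C x0 x1 y z + eo A B C x0' x1' y' z' =
  eo A B C (x0 + x0') (x1 + x1') (y + y') (z + z').
Proof. by rewrite /eo; apply: row4P; rewrite mxE !row4E; ring. Qed.

Lemma eo_scalar A B C a : (a *: 1 : quartic_ring (palin A B C)) = eo A B C a 0 0 0.
Proof. by rewrite /eo; apply: row4P; rewrite mxE !row4E; ring. Qed.

(** This is t -> 1/t in the basis 1, w1, w2, w3; for instance A / t = - w3 - B. *)
Definition qinv A B C (x : quartic_ring (palin A B C)) : quartic_ring (palin A B C) :=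
  let c k : R := x 0 (inord k) in
  row4 (c 0%N - B * c 1%N - (C + 2 * A) * c 2%N - B * c 3%N) (- c 3%N) (- c 2%N) (- c 1%N).

Lemma qinvM A B C : {morph @qinv A B C : x y / x * y}.
Proof.
by move=> x y; apply: row4P; rewrite !qmulE /qinv /qmul !row4E /=; ring.
Qed.

Lemma qinvX A B C x n : @qinv A B C (x ^+ n) = qinv x ^+ n.
Proof.
elim: n => [|n IHn]; last by rewrite !exprS qinvM IHn.
by rewrite !expr0; apply: row4P; rewrite /qinv !row4E; ring.
Qed.

Lemma qinv_eo A B C x0 x1 y z :
  qinv (eo A B C x0 x1 y z : quartic_ring (palin A B C)) = eo A B C x0 x1 (- y) (- z).
Proof. by rewrite /qinv /eo; apply: row4P; rewrite !row4E; ring. Qed.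

Lemma nilp_qinv A B C x : nilp x -> nilp (@qinv A B C x).
Proof.
case=> n xn; exists n; rewrite -qinvX xn.
by apply: row4P; rewrite /qinv !row4E !mxE; ring.
Qed.

End Palindromic.

Lemma map_palin (R S : comNzRingType) (f : {rmorphism R -> S}) (A B C : R) :
  map_bqf f (palin A B C) = palin (f A) (f B) (f C).
Proof. by rewrite /palin /map_bqf /= rmorphD rmorphM rmorph_nat. Qed.

(** * Nilpotents over a field in which 2 is invertible *)

Section NilpotentField.
Variables (k : fieldType) (a b c : k).
Hypothesis k2 : (2 : k) != 0.
Local Notation eo := (eo a b c).
Local Notation Q := (quartic_ring (palin a b c)).
Local Notation D := (b ^+ 2 - 4 * a * c).

(* In the quadratic ring of even elements, a nilpotent has norm and trace 0. *)
Lemma nilp_even x0 x1 : nilp (eo x0 x1 0 0 : Q) -> 2 * x0 = b * x1 /\ D * x1 = 0.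
Proof.
set x : Q := eo _ _ _ _ => nx; pose tr := 2 * x0 - b * x1.
pose N := x0 ^+ 2 - b * x0 * x1 + a * c * x1 ^+ 2.
have N0 : N = 0.
  have [n] : nilp (N *: 1 : Q).
    (* As [al] has trace [- b], the first factor is the conjugate of [x]. *)
    have -> : (N *: 1 : Q) = (eo (x0 - b * x1) (- x1) 0 0 : Q) * x.
      by rewrite /x eoM eo_scalar /N; congr (eo _ _ _ _); ring.
    exact: nilpM.
  rewrite exprZn expr1n => /row4_eq0 [+ _ _ _]; rewrite !(row4E, mxE) mulr1.
  by move=> /eqP; rewrite expf_eq0 => /andP [_ /eqP].
(* With norm 0, the powers of [x] are [tr ^+ m *: x]; if [tr] were nonzero, nilpotence would force
   [x = 0], hence [tr = 0]. *)
have x2 : x * x = tr *: x.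
  rewrite /x eoM eoZ /tr; congr (eo _ _ _ _); try ring.
  by apply/eqP; rewrite -subr_eq0; apply/eqP; apply: (eq0_lincomb1 (- 1) N0); rewrite /N; ring.
have tr0 : tr = 0.
  have [n xn] := nx.
  have xS m : x ^+ m.+1 = tr ^+ m *: x.
    elim: m => [|m IHm]; first by rewrite expr1 scale1r.
    by rewrite exprSr IHm -scalerAl x2 scalerA -exprSr.
  have : tr ^+ n *: x = 0 by rewrite -xS exprSr xn mul0r.
  rewrite /x eoZ => /row4_eq0 []; rewrite !row4E => e0 e1 _ _.
  have [tn|tn] := eqVneq (tr ^+ n) 0.
    by move/eqP: tn; rewrite expf_eq0 => /andP [_ /eqP].
  have x10 : x1 = 0 by apply: (mulfI tn); rewrite mulr0 -[RHS]e1; ring.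
  have x00 : x0 = 0.
    by apply: (mulfI tn); rewrite mulr0 -[RHS]e0 x10; ring.
  by rewrite /tr x00 x10; ring.
split; first by apply/eqP; rewrite -subr_eq0; apply/eqP.
(* The discriminant identity: [D * x1 ^+ 2 = tr ^+ 2 - 4 * N]. *)
have : D * x1 * x1 = 0 by apply: (eq0_lincomb2 tr (- 4) tr0 N0); rewrite /tr /N; ring.
by move/eqP; rewrite mulf_eq0 => /orP [/eqP //|/eqP ->]; rewrite mulr0.
Qed.

(** The conjugate of a nilpotent is nilpotent, so half the sum is a nilpotent even part and the odd
    part is nilpotent too. The last two equations are [nilp_even] for minus the square of the odd
    part. *)
Lemma nilp_eo x0 x1 y z : nilp (eo x0 x1 y z : Q) ->
  [/\ 2 * x0 = b * x1, D * x1 = 0,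
      2 * (a * (c + 4 * a) * y ^+ 2 + 8 * a * b * y * z
         + (4 * b ^+ 2 - 4 * a * c - c ^+ 2) * z ^+ 2)
      = b * (b * y ^+ 2 + 2 * (c + 4 * a) * y * z + 4 * b * z ^+ 2) &
      D * (b * y ^+ 2 + 2 * (c + 4 * a) * y * z + 4 * b * z ^+ 2) = 0].
Proof.
move=> ns.
have [n0 n1] : 2 * x0 = b * x1 /\ D * x1 = 0.
  have := nilpD ns (nilp_qinv ns); rewrite qinv_eo eoD !subrr => /nilp_even [e0 e1].
  split; apply: (mulfI k2); [rewrite [2 * x0]mulr_natl mulr2n e0; ring|].
  by rewrite mulr0 -[RHS]e1; ring.
have nx : nilp (eo x0 x1 0 0 : Q).
  have [m] := nilpD ns (nilp_qinv ns); rewrite qinv_eo eoD !subrr => e.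
  exists m; have -> : (eo x0 x1 0 0 : Q) = 2^-1 *: (eo (x0 + x0) (x1 + x1) 0 0 : Q).
    by rewrite eoZ; congr (eo _ _ _ _); field.
  by rewrite exprZn e scaler0.
have ny : nilp (eo 0 0 y z : Q).
  have -> : (eo 0 0 y z : Q) = eo x0 x1 y z + (- 1) * (eo x0 x1 0 0 : Q).
    by rewrite mulN1r -scaleN1r eoZ eoD; congr (eo _ _ _ _); ring.
  by apply: nilpD => //; apply: nilpM.
have := nilpM (eo 0 0 y z : Q) ny; rewrite eoM.
set y0 := (X in eo X); set y1 := (X in eo _ X); set y2 := (X in eo _ _ X).
set y3 := (X in eo _ _ _ X).
have -> : y2 = 0 by rewrite /y2; ring.
have -> : y3 = 0 by rewrite /y3; ring.
move=> /nilp_even [e0 e1]; split=> //.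
  by apply/eqP; rewrite -subr_eq0; apply/eqP; apply: (eq0_lincomb1 (- 1) e0); rewrite /y0 /y1; ring.
by apply: (eq0_lincomb1 (- 1) e1); rewrite /y1; ring.
Qed.

End NilpotentField.

(** * Saturated ideals when 2 is a unit *)

Section OddPrime.
Variables (R : comNzRingType) (k : fieldType) (rho : {rmorphism R -> k}) (pi : R).
Hypotheses (rm : residue_map rho pi) (two_neq0 : rho 2 != 0).
Variables A B C : R.
Local Notation F := (palin A B C).
Local Notation S := (quartic_ring F).
Local Notation e := (eo A B C : R -> R -> R -> R -> S).
Local Notation red := (@base_change _ _ rho F).

Let k2 : (2 : k) != 0. Proof. by rewrite -(rmorph_nat rho). Qed.

Lemma red_eo_eq x0 x1 y z x0' x1' y' z' :
  rho x0 = rho x0' -> rho x1 = rho x1' -> rho y = rho y' -> rho z = rho z' ->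
  red (e x0 x1 y z) = red (e x0' x1' y' z').
Proof.
move=> e0 e1 e2 e3; apply: row4P; rewrite [LHS]mxE [RHS]mxE /eo !row4E;
  by rewrite !(rmorphB, rmorphD, rmorphM) ?e0 ?e1 ?e2 ?e3.
Qed.

Lemma eo_ex (s : S) : exists x0 x1 y z, s = e x0 x1 y z.
Proof.
have [h h2] := residue_unit rm two_neq0.
pose x1 := (s 0 (inord 1) - s 0 (inord 3)) * h.
pose y := (s 0 (inord 1) + s 0 (inord 3)) * h.
pose z := s 0 (inord 2) * h.
exists (s 0 (inord 0) + B * x1 - B * y - (C + 2 * A) * z), x1, y, z.
apply: row4P; rewrite /eo !row4E /x1 /y /z; try ring.
- by transitivity (s 0 (inord 1) * (2 * h)); [rewrite h2 mulr1|ring].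
- by transitivity (s 0 (inord 2) * (2 * h)); [rewrite h2 mulr1|ring].
- by transitivity (s 0 (inord 3) * (2 * h)); [rewrite h2 mulr1|ring].
Qed.

Lemma nilp_red_eo x0 x1 y z : nilp (red (e x0 x1 y z)) ->
  [/\ 2 * rho x0 = rho B * rho x1, rho (B ^+ 2 - 4 * A * C) * rho x1 = 0,
      2 * rho (A * (C + 4 * A) * y ^+ 2 + 8 * A * B * y * z
         + (4 * B ^+ 2 - 4 * A * C - C ^+ 2) * z ^+ 2)
      = rho B * rho (B * y ^+ 2 + 2 * (C + 4 * A) * y * z + 4 * B * z ^+ 2) &
      rho (B ^+ 2 - 4 * A * C)
        * rho (B * y ^+ 2 + 2 * (C + 4 * A) * y * z + 4 * B * z ^+ 2) = 0].
Proof.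
move=> [n]; have : red (e x0 x1 y z) =
    eo (rho A) (rho B) (rho C) (rho x0) (rho x1) (rho y) (rho z).
  by apply: row4P; rewrite [LHS]mxE /eo !row4E; ring.
move: (red (e x0 x1 y z)); rewrite map_palin => s -> sn.
have /(nilp_eo k2) : nilp (eo (rho A) (rho B) (rho C) (rho x0) (rho x1) (rho y) (rho z)
    : quartic_ring (palin (rho A) (rho B) (rho C))) by exists n.
case=> e0 e1 e2 e3; split=> //.
- by apply: etrans _ (etrans e1 _) => //; ring.
- by apply: etrans _ (etrans e2 _); ring.
- by apply: etrans _ (etrans e3 _) => //; ring.
Qed.

Local Notation D := (B ^+ 2 - 4 * A * C).
Local Notation P := (4 * A + 2 * B + C).
Local Notation N := (4 * A - 2 * B + C).

Variable I : S -> Prop.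
Hypothesis sI : saturated rho pi I.

Lemma sat_eo x0 x1 y z : I (e x0 x1 y z) ->
  [/\ 2 * rho x0 = rho B * rho x1, rho D * rho x1 = 0,
      2 * rho (A * (C + 4 * A) * y ^+ 2 + 8 * A * B * y * z
         + (4 * B ^+ 2 - 4 * A * C - C ^+ 2) * z ^+ 2)
      = rho B * rho (B * y ^+ 2 + 2 * (C + 4 * A) * y * z + 4 * B * z ^+ 2) &
      rho D
        * rho (B * y ^+ 2 + 2 * (C + 4 * A) * y * z + 4 * B * z ^+ 2) = 0].
Proof. by move=> Is; apply: nilp_red_eo; apply: (sat_nil sI). Qed.

(** The element itself need not be in [I]: nilpotence of its square is enough. *)
Lemma sat_sq_eo x0 x1 y z : I (e x0 x1 y z * e x0 x1 y z) ->
  [/\ 2 * rho x0 = rho B * rho x1, rho D * rho x1 = 0,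
      2 * rho (A * (C + 4 * A) * y ^+ 2 + 8 * A * B * y * z
         + (4 * B ^+ 2 - 4 * A * C - C ^+ 2) * z ^+ 2)
      = rho B * rho (B * y ^+ 2 + 2 * (C + 4 * A) * y * z + 4 * B * z ^+ 2) &
      rho D
        * rho (B * y ^+ 2 + 2 * (C + 4 * A) * y * z + 4 * B * z ^+ 2) = 0].
Proof.
move=> /(sat_nil sI) [n sn]; apply: nilp_red_eo; exists (2 * n)%N.
by rewrite exprM -[RHS]sn expr2 -rmorphM.
Qed.

(** Multiplication by [be] and by [ga] moves [y] and [z] into the even part, where the trace
    condition of [sat_eo] applies. *)
Lemma sat_eo_odd x0 x1 y z : I (e x0 x1 y z) -> rho D = 0 ->
  rho (C - 4 * A) * (2 * rho A * rho y + rho B * rho z) = 0 /\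
  rho (C - 4 * A) * (rho B * rho y + 2 * rho C * rho z) = 0.
Proof.
move=> Is D0.
have := sat_mul sI (e 0 0 1 0) Is; rewrite eoM => /sat_eo [eb _ _ _].
have := sat_mul sI (e 0 0 0 1) Is; rewrite eoM => /sat_eo [eg _ _ _].
split; apply: (mulfI k2); rewrite mulr0.
  by apply: (eq0_lincomb2 2 (- (2 * rho y)) eb D0); ring.
by apply: (eq0_lincomb2 2 (8 * rho z) eg D0); ring.
Qed.
(** When [D] is a unit, the coordinate of [al] vanishes modulo [pi] on all of [I]; this is applied
    to the element and to its products with [be] and [ga]. *)
Lemma sat_eo_unit x0 x1 y z : I (e x0 x1 y z) -> rho D != 0 ->
  [/\ rho x0 = 0, rho x1 = 0, rho B * rho y + rho (C + 4 * A) * rho z = 0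
    & rho (C + 4 * A) * rho y + 4 * rho B * rho z = 0].
Proof.
move=> Is nD.
have x10 x0' x1' y' z' : I (e x0' x1' y' z') -> rho x1' = 0.
  by move=> /sat_eo [_ ex _ _]; apply: (mulfI nD); rewrite ex mulr0.
have x1_0 := x10 _ _ _ _ Is; split=> //.
- by have [e0 _ _ _] := sat_eo Is; apply: (mulfI k2); rewrite e0 x1_0 !mulr0.
- have := sat_mul sI (e 0 0 1 0) Is; rewrite eoM => /x10 eb.
  by apply: (eq0_lincomb1 (- 1) eb); ring.
have := sat_mul sI (e 0 0 0 1) Is; rewrite eoM => /x10 eg.
by apply: (eq0_lincomb1 (- 1) eg); ring.
Qed.

(** The square of the element is [pi *: m], and [m] is again in [I]. By [sat_eo_unit] the even
    coordinates of [m] vanish modulo [pi], which supplies the second factor [pi]. *)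
Lemma sat_eo_sq x0 x1 y z : I (e x0 x1 y z) -> rho D != 0 ->
  (exists d, B * y ^+ 2 + 2 * (C + 4 * A) * y * z + 4 * B * z ^+ 2 = pi ^+ 2 * d) /\
  (exists d, A * (C + 4 * A) * y ^+ 2 + 8 * A * B * y * z
         + (4 * B ^+ 2 - 4 * A * C - C ^+ 2) * z ^+ 2 = pi ^+ 2 * d).
Proof.
move=> Is nD; have [ex0 ex1 _ _] := sat_eo_unit Is nD.
have [_ _ e0 /eqP] := sat_eo Is; rewrite mulf_eq0 (negPf nD) /= => /eqP c1.
have {e0} c0 := e0; rewrite c1 mulr0 in c0.
have {}c0 := mulfI k2 (etrans c0 (esym (mulr0 _))).
move: Is c0 c1 => Is /(residue_ker rm) [d0 c0] /(residue_ker rm) [d1 c1].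
move: ex0 ex1 Is => /(residue_ker rm) [x0' ->] /(residue_ker rm) [x1' ->] Is.
pose m := e (pi * x0' ^+ 2 - pi * A * C * x1' ^+ 2 - d0)
  (2 * pi * x0' * x1' - pi * B * x1' ^+ 2 - d1)
  (2 * (x0' * y - B * x1' * y - C * x1' * z)) (2 * (x0' * z + A * x1' * y)).
have Im : I m.
  apply: (sat_div sI Is Is); rewrite eoM eoZ; congr (eo _ _ _ _ _ _ _); try ring.
  - by rewrite !mulrBr -c0; ring.
  - by rewrite !mulrBr -c1; ring.
have [em0 em1 _ _] := sat_eo_unit Im nD.
rewrite c0 c1; split.
  suff /(residue_ker rm) [d ->] : rho d1 = 0 by exists d; ring.
  by apply: (eq0_lincomb2 (- 1) 0 em1 em1);
    rewrite !(rmorphB, rmorphM, rmorphXn) (residue_pi rm); ring.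
suff /(residue_ker rm) [d ->] : rho d0 = 0 by exists d; ring.
by apply: (eq0_lincomb2 (- 1) 0 em0 em0);
    rewrite !(rmorphB, rmorphM, rmorphXn) (residue_pi rm); ring.
Qed.

Lemma pi2_div u w t d : u = pi * w -> rho w != 0 -> u * t = pi ^+ 2 * d -> rho t = 0.
Proof.
move=> -> nw e1; suff : rho w * rho t = 0.
  by move/eqP; rewrite mulf_eq0 (negPf nw) => /eqP.
rewrite -rmorphM; apply/(residue_ker rm); exists d.
apply/eqP; rewrite -subr_eq0; apply/eqP/(residue_reg rm).
by rewrite mulrBr !mulrA e1 -expr2 subrr.
Qed.

Hypothesis nP : forall u, P = pi * u -> rho u != 0.
Hypothesis nN : forall u, N = pi * u -> rho u != 0.
Hypothesis nD : forall u, D = pi * u -> rho u != 0.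

(* The even part of [s * s] is a multiple of [pi ^+ 2] by [sat_eo_sq]; combining
   its coordinates gives [P] and [N] times the forms in [q1] and [q2]. *)
Lemma odd_unit_disc x0 x1 y z : rho D != 0 -> I (e x0 x1 y z) ->
  [/\ rho x0 = 0, rho x1 = 0, rho y = 0 & rho z = 0].
Proof.
move=> D0 Is; have [-> -> eb eg] := sat_eo_unit Is D0.
have [[d1 c1] [d0 c0]] := sat_eo_sq Is D0.
have k4 : (4 : k) != 0 by rewrite (_ : 4 = 2 * 2) ?mulf_neq0 //; ring.
have q1 : rho P = 0 ->
    rho A * rho y ^+ 2 + 4 * rho A * rho y * rho z + (2 * rho B - rho C) * rho z ^+ 2 = 0.
  move=> /(residue_ker rm) [w ew].
  suff : rho (A * y ^+ 2 + 4 * A * y * z + (2 * B - C) * z ^+ 2) = 0.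
    by move=> <-; ring.
  apply: (@pi2_div P w _ (d0 + 2 * A * d1) ew (nP ew)).
  rewrite (_ : pi ^+ 2 * _ = pi ^+ 2 * d0 + 2 * A * (pi ^+ 2 * d1)); last by ring.
  by rewrite -c1 -c0; ring.
have q2 : rho N = 0 ->
    rho A * rho y ^+ 2 - 4 * rho A * rho y * rho z - (2 * rho B + rho C) * rho z ^+ 2 = 0.
  move=> /(residue_ker rm) [w ew].
  suff : rho (A * y ^+ 2 - 4 * A * y * z - (2 * B + C) * z ^+ 2) = 0.
    by move=> <-; ring.
  apply: (@pi2_div N w _ (d0 - 2 * A * d1) ew (nN ew)).
  rewrite (_ : pi ^+ 2 * _ = pi ^+ 2 * d0 - 2 * A * (pi ^+ 2 * d1)); last by ring.
  by rewrite -c1 -c0; ring.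
suff [-> ->] : rho y = 0 /\ rho z = 0 by [].
have sq0 (u : k) : u ^+ 2 = 0 -> u = 0 by move/eqP; rewrite expf_eq0 => /eqP.
(* The system [eb], [eg] in [y], [z] has determinant [- P * N], so [q1] and [q2] serve only when [P]
   or [N] vanishes. If both vanish, their left sides are A (y + 2 z)^2 and A (y - 2 z)^2. *)
have [P0|P0] := eqVneq (rho P) 0; have [N0|N0] := eqVneq (rho N) 0.
- have B0 : rho B = 0.
    by apply: (mulfI k4); rewrite mulr0; apply: (eq0_lincomb2 1 (- 1) P0 N0); ring.
  have C0 : rho C = - (4 * rho A).
    by apply/eqP; rewrite -subr_eq0 opprK; apply/eqP; apply: (eq0_lincomb2 1 (- 2) P0 B0); ring.
  have A0 : rho A != 0.
    apply: contraNneq D0 => A0; apply/eqP.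
    by apply: (eq0_lincomb2 (rho B) (- (4 * rho C)) B0 A0); ring.
  have y1 : rho y + 2 * rho z = 0.
    by apply: sq0; apply: (mulfI A0); rewrite mulr0; have := q1 P0; rewrite B0 C0 => <-; ring.
  have y2 : rho y - 2 * rho z = 0.
    by apply: sq0; apply: (mulfI A0); rewrite mulr0; have := q2 N0; rewrite B0 C0 => <-; ring.
  split; first by apply: (mulfI k2); rewrite mulr0; apply: (eq0_lincomb2 1 1 y1 y2); ring.
  by apply: (mulfI k4); rewrite mulr0; apply: (eq0_lincomb2 1 (- 1) y1 y2); ring.
- have C0 : rho C = - (4 * rho A) - 2 * rho B.
    by apply/eqP; rewrite -subr_eq0; apply/eqP; apply: (eq0_lincomb1 1 P0); ring.
  have B0 : rho B != 0.
    by apply: contraNneq N0 => B0; apply/eqP; apply: (eq0_lincomb2 1 (- 4) C0 B0); ring.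
  have y1 : rho y = 2 * rho z.
    apply/eqP; rewrite -subr_eq0; apply/eqP; apply: (mulfI B0); rewrite mulr0.
    by rewrite -[RHS]eb rmorphD C0; ring.
  (* When [P] vanishes, [D] is (4 A + B)^2 modulo [pi]. *)
  have D1 : 4 * (4 * rho A + rho B) != 0.
    rewrite mulf_neq0 //; apply: contraNneq D0 => e0; apply/eqP.
    by apply: (eq0_lincomb2 (rho B + 4 * rho A) (- (4 * rho A)) e0 P0); ring.
  suff z0 : rho z = 0 by rewrite y1 z0 mulr0.
  apply: sq0; apply: (mulfI D1); rewrite mulr0; have := q1 P0; rewrite y1 C0 => <-; ring.
- have C0 : rho C = 2 * rho B - 4 * rho A.
    by apply/eqP; rewrite -subr_eq0; apply/eqP; apply: (eq0_lincomb1 1 N0); ring.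
  have B0 : rho B != 0.
    by apply: contraNneq P0 => B0; apply/eqP; apply: (eq0_lincomb2 1 4 C0 B0); ring.
  have y1 : rho y = - (2 * rho z).
    apply/eqP; rewrite -subr_eq0; apply/eqP; apply: (mulfI B0); rewrite mulr0.
    by rewrite -[RHS]eb rmorphD C0; ring.
  have D1 : 4 * (4 * rho A - rho B) != 0.
    rewrite mulf_neq0 //; apply: contraNneq D0 => e0; apply/eqP.
    by apply: (eq0_lincomb2 (4 * rho A - rho B) (- (4 * rho A)) e0 N0); ring.
  suff z0 : rho z = 0 by rewrite y1 z0 mulr0 oppr0.
  apply: sq0; apply: (mulfI D1); rewrite mulr0; have := q2 N0; rewrite y1 C0 => <-; ring.
have PN : rho P * rho N != 0 by rewrite mulf_neq0.
split; apply: (mulfI PN); rewrite mulr0.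
  by apply: (eq0_lincomb2 (rho (C + 4 * A)) (- 4 * rho B) eg eb); ring.
by apply: (eq0_lincomb2 (- rho B) (rho (C + 4 * A)) eg eb); ring.
Qed.

Lemma sat_scale u s : rho u != 0 -> I (u *: s) -> I s.
Proof.
move=> /(residue_unit rm) [v uv] /(sat_mul sI (v *: 1)).
by rewrite -scalerAl mul1r scalerA mulrC uv scale1r.
Qed.

(** The element nu = B + 2 al, written [e B 2 0 0], satisfies nu^2 = D = pi d with [d] a unit, so
    (nu l)^2 is [pi] times a unit multiple of l^2. *)
Lemma sat_nu l : rho D = 0 -> I (e B 2 0 0 * l) -> I (l * l).
Proof.
move=> /(residue_ker rm) [d ed] Il; apply: (@sat_scale d); first exact: (nD ed).
apply: (sat_div sI Il Il).
have -> : e B 2 0 0 * l * (e B 2 0 0 * l) = e B 2 0 0 * e B 2 0 0 * (l * l) by ring.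
have -> : e B 2 0 0 * e B 2 0 0 = D *: 1.
  by rewrite eoM eo_scalar; congr (eo _ _ _ _ _ _ _); ring.
by rewrite -scalerAl mul1r ed scalerA.
Qed.

Hypothesis nABC : ~ [/\ rho A = 0, rho B = 0 & rho C = 0].

(** Modulo [pi] the element is nu l, with l = x1 / 2 + j be when A is a unit and l = x1 / 2 + j ga
    otherwise. By [sat_nu] the square of l is in [I], and the trace conditions on l force x1 = 0 and
    j = 0. *)
Lemma odd_zero_disc x0 x1 y z : rho D = 0 -> rho (C - 4 * A) != 0 ->
  I (e x0 x1 y z) -> [/\ rho x0 = 0, rho x1 = 0, rho y = 0 & rho z = 0].
Proof.
move=> D0 CA Is; have [e0 _ _ _] := sat_eo Is.
have [fa fc] := sat_eo_odd Is D0.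
have ea := mulfI CA (etrans fa (esym (mulr0 _))).
have ec := mulfI CA (etrans fc (esym (mulr0 _))).
have [h h2] := residue_unit rm two_neq0.
have h2' : 2 * rho h = 1 by have := congr1 rho h2; rewrite rmorph1 rmorphM rmorph_nat.
have [A0|A0] := eqVneq (rho A) 0; last first.
  have [A' A'1] := residue_unit rm A0.
  have A'k : rho A * rho A' = 1 by rewrite -rmorphM A'1 rmorph1.
  pose j := z * h * A'.
  have zj : rho z = 2 * rho A * rho j.
    transitivity (rho z * (2 * rho h) * (rho A * rho A')); last by rewrite /j; ring.
    by rewrite h2' A'k !mulr1.
  have yj : rho y = - (rho B * rho j).
    apply/eqP; rewrite -subr_eq0; apply/eqP; apply: (mulfI k2); apply: (mulfI A0).
    by rewrite !mulr0 -[RHS]ea zj; ring.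
  have /(sat_nu D0) Il : I (e B 2 0 0 * e (x1 * h) 0 j 0).
    rewrite eoM; apply: (sat_red rm sI _ Is); apply: red_eo_eq.
    - apply: (mulfI k2); rewrite e0.
      by transitivity (rho B * rho x1 * (2 * rho h)); [rewrite h2' mulr1|ring].
    - by transitivity (rho x1 * (2 * rho h)); [rewrite h2' mulr1|ring].
    - by rewrite yj; ring.
    - by rewrite zj; ring.
  have [ex0 _ ej _] := sat_sq_eo Il.
  have x10 : rho x1 = 0.
    transitivity (rho x1 * (2 * rho h)); first by rewrite h2' mulr1.
    by rewrite -[RHS](mulr0 (rho B)) -(rmorph0 rho) -ex0; ring.
  have j0 : rho j = 0.
    apply/eqP; have : 4 * rho A * rho (C - 4 * A) * rho j ^+ 2 = 0.
      by apply: (eq0_lincomb2 (- 2) (- (2 * rho j ^+ 2)) ej D0); ring.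
    have k4 : (4 : k) != 0 by rewrite (_ : 4 = 2 * 2) ?mulf_neq0 //; ring.
    by move/eqP; rewrite !mulf_eq0 (negPf k4) (negPf A0) (negPf CA) /= orbb.
  have x00 : rho x0 = 0 by apply: (mulfI k2); rewrite e0 x10 !mulr0.
  by split=> //; [rewrite yj j0 mulr0 oppr0|rewrite zj j0 mulr0].
have B0 : rho B = 0.
  apply/eqP; have : rho B ^+ 2 = 0 by apply: (eq0_lincomb2 1 (4 * rho C) D0 A0); ring.
  by move/eqP; rewrite expf_eq0.
have C0 : rho C != 0 by apply/eqP => C0; apply: nABC.
have [C' C'1] := residue_unit rm C0.
have C'k : rho C * rho C' = 1 by rewrite -rmorphM C'1 rmorph1.
pose j := - (y * h * C').
have yj : rho y = - (2 * rho C * rho j).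
  transitivity (rho y * (2 * rho h) * (rho C * rho C')); last by rewrite /j; ring.
  by rewrite h2' C'k !mulr1.
have z0 : rho z = 0.
  apply: (mulfI k2); apply: (mulfI C0).
  by rewrite !mulr0 -[RHS]ec B0; ring.
have /(sat_nu D0) Il : I (e B 2 0 0 * e (x1 * h) 0 0 j).
  rewrite eoM; apply: (sat_red rm sI _ Is); apply: red_eo_eq.
  - apply: (mulfI k2); rewrite e0.
    by transitivity (rho B * rho x1 * (2 * rho h)); [rewrite h2' mulr1|ring].
  - by transitivity (rho x1 * (2 * rho h)); [rewrite h2' mulr1|ring].
  - by rewrite yj; ring.
  - rewrite z0; transitivity (rho B * rho j); [by rewrite B0 mul0r|ring].
have [ex0 _ ej _] := sat_sq_eo Il.
have x10 : rho x1 = 0.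
  transitivity (rho x1 * (2 * rho h)); first by rewrite h2' mulr1.
  by rewrite -[RHS](mulr0 (rho B)) -(rmorph0 rho) -ex0; ring.
have j0 : rho j = 0.
  apply/eqP; have : 2 * rho C ^+ 2 * rho j ^+ 2 = 0.
    apply: (eq0_lincomb3 (- 1) (4 * rho B * rho j ^+ 2) (- (8 * rho C * rho j ^+ 2)) ej B0 A0).
    ring.
  by move/eqP; rewrite !mulf_eq0 (negPf k2) (negPf C0) /= orbb.
have x00 : rho x0 = 0 by apply: (mulfI k2); rewrite e0 x10 !mulr0.
by split=> //; rewrite yj j0 mulr0 oppr0.
Qed.

(** Here C = 4 A and B = 4 A or - 4 A modulo [pi], so F is A (x + y)^4 or A (x - y)^4 and [S / pi S]
    is local with a one-dimensional socle. It suffices that [I] does not meet the socle outside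
    0. *)
Lemma odd_total_ramified x0 x1 y z : rho D = 0 -> rho (C - 4 * A) = 0 ->
  I (e x0 x1 y z) -> [/\ rho x0 = 0, rho x1 = 0, rho y = 0 & rho z = 0].
Proof.
move=> D0 CA Is; have [e0 _ _ _] := sat_eo Is.
have k4 : (4 : k) != 0 by rewrite (_ : 4 = 2 * 2) ?mulf_neq0 //; ring.
have C4 : rho C = 4 * rho A by apply/eqP; rewrite -subr_eq0; apply/eqP; rewrite -[RHS]CA; ring.
have B2 : rho B ^+ 2 = 16 * rho A ^+ 2.
  apply/eqP; rewrite -subr_eq0; apply/eqP.
  by apply: (eq0_lincomb2 1 (4 * rho A) D0 CA); ring.
have A0 : rho A != 0.
  apply/eqP => A0; apply: nABC; split=> //; last by rewrite C4 A0 mulr0.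
  by apply/eqP; rewrite -sqrf_eq0 B2 A0 expr0n mulr0.
have B0 : rho B != 0.
  by rewrite -sqrf_eq0 B2 mulf_neq0 ?expf_neq0 // (_ : 16 = 4 * 4) ?mulf_neq0 //; ring.
have [h h2] := residue_unit rm two_neq0.
have h2' : 2 * rho h = 1 by have := congr1 rho h2; rewrite rmorph1 rmorphM rmorph_nat.
have h0 : rho h != 0 by apply: contra_eq_neq h2' => ->; rewrite mulr0 eq_sym oner_eq0.
have [A' A'1] := residue_unit rm A0.
have A'k : rho A * rho A' = 1 by rewrite -rmorphM A'1 rmorph1.
(* The class of [e 0 0 (- B) (2 * A)] spans the socle of [S / pi S]. *)
have nmu w : I (e 0 0 (- (w * B)) (w * (2 * A))) -> rho w = 0.
  move=> Iw; apply/eqP/negPn/negP => /(residue_unit rm) [w' ww'].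
  (* From nu be in [I] follows be^2 in [I]; modulo [pi] this is - (B / 2) nu, a unit multiple of nu,
     and nu in [I] in turn gives 1 in [I]. *)
  have {Iw} /(sat_nu D0) Ib : I (e B 2 0 0 * e 0 0 1 0).
    have := sat_mul sI (w' *: 1) Iw; rewrite -scalerAl mul1r eoZ eoM.
    congr (I (eo _ _ _ _ _ _ _)); ring: ww'.
  have /(sat_scale _) : I (- (B * h) *: e B 2 0 0).
    move: Ib; rewrite eoM eoZ; apply: (sat_red rm sI); apply: red_eo_eq; try ring.
      apply: (mulfI k2).
      transitivity (- (rho B ^+ 2 * (2 * rho h))); last by ring.
      rewrite h2' mulr1; apply: subr0_eq.
      by apply: (eq0_lincomb2 1 (- (2 * rho A)) B2 CA); ring.
    transitivity (- (rho B * (2 * rho h))); last by ring.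
    by rewrite h2' mulr1; ring.
  rewrite rmorphN rmorphM oppr_eq0 mulf_neq0 // => /(_ isT) Inu.
  have /(sat_nu D0) /(sat_nil sI) [n] : I (e B 2 0 0 * 1) by rewrite mulr1.
  by rewrite mulr1 rmorph1 expr1n => /eqP; rewrite oner_eq0.
(* Successively nu s, be s and s itself are seen to be socle elements modulo [pi], with coefficients
   [w], [x1 * h] and [z * h * A']. *)
pose w := y + B * z * h * A'.
have w0 : rho w = 0.
  apply: nmu; have := sat_mul sI (e B 2 0 0) Is; rewrite eoM.
  apply: (sat_red rm sI); apply: red_eo_eq.
  - apply: (mulfI k2); apply: subr0_eq.
    by apply: (eq0_lincomb2 (rho B) (rho x1) e0 D0); ring.
  - by apply: subr0_eq; apply: (eq0_lincomb1 1 e0); ring.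
  - apply: (mulfI k2); apply: (mulfI A0); apply: subr0_eq.
    by apply: (eq0_lincomb3 (rho B ^+ 2 * rho z * (rho A * rho A')) (rho B ^+ 2 * rho z)
      (rho z) h2' A'k D0); rewrite /w; ring.
  apply: subr0_eq.
  by apply: (eq0_lincomb2 (- (rho B * rho z * (rho A * rho A'))) (- (rho B * rho z)) h2' A'k);
    rewrite /w; ring.
have ez : 2 * rho A * rho y + rho B * rho z = 0.
  by apply: (eq0_lincomb3 (2 * rho A) (- (rho B * rho z * (rho A * rho A'))) (- (rho B * rho z))
    w0 h2' A'k); rewrite /w; ring.
have v0 : rho (x1 * h) = 0.
  apply: nmu; have := sat_mul sI (e 0 0 1 0) Is; rewrite eoM.
  apply: (sat_red rm sI); apply: red_eo_eq.
  - apply: subr0_eq.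
    by apply: (eq0_lincomb2 (- (rho A * rho y)) (- (4 * rho A)) CA ez); ring.
  - apply: (mulfI k2); apply: (mulfI A0); apply: subr0_eq.
    by apply: (eq0_lincomb3 (- rho B) (rho z) (- (2 * rho A * rho z)) ez B2 CA); ring.
  - apply: (mulfI k2); apply: subr0_eq.
    by apply: (eq0_lincomb2 1 (rho x1 * rho B) e0 h2'); ring.
  by apply: subr0_eq; apply: (eq0_lincomb1 (- (rho A * rho x1)) h2'); ring.
have x10 : rho x1 = 0 by apply: (eq0_lincomb2 2 (- rho x1) v0 h2'); ring.
have x00 : rho x0 = 0 by apply: (mulfI k2); rewrite e0 x10 !mulr0.
have u0 : rho (z * h * A') = 0.
  apply: nmu; apply: (sat_red rm sI _ Is); apply: red_eo_eq.
  - by rewrite x00 rmorph0.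
  - by rewrite x10 rmorph0.
  - apply: (mulfI k2); apply: (mulfI A0); apply: subr0_eq.
    by apply: (eq0_lincomb3 1 (rho B * rho z * (rho A * rho A')) (rho B * rho z) ez h2' A'k); ring.
  apply: subr0_eq.
  by apply: (eq0_lincomb2 (- (rho z * (rho A * rho A'))) (- rho z) h2' A'k); ring.
have z0 : rho z = 0.
  by apply: (eq0_lincomb3 (2 * rho A) (- (rho z * (rho A * rho A'))) (- rho z) u0 h2' A'k); ring.
split=> //; apply: (mulfI k2); apply: (mulfI A0).
by apply: subr0_eq; apply: (eq0_lincomb2 1 (- rho B) ez z0); ring.
Qed.

Lemma odd_red_eq0 (s : S) : I s -> red s = 0.
Proof.
have [x0 [x1 [y [z ->]]]] := eo_ex s => Is.
suff [x00 x10 y0 z0] : [/\ rho x0 = 0, rho x1 = 0, rho y = 0 & rho z = 0].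
  rewrite (@red_eo_eq _ _ _ _ 0 0 0 0) ?rmorph0 //.
  by apply: row4P; rewrite [LHS]mxE [RHS]mxE /eo !row4E; ring.
have [D0|D0] := eqVneq (rho D) 0; last exact: odd_unit_disc Is.
have [CA|CA] := eqVneq (rho (C - 4 * A)) 0; first exact: odd_total_ramified Is.
exact: odd_zero_disc Is.
Qed.

End OddPrime.

(** * The prime 2 *)

Section Two.
Variables (R : comNzRingType) (rho : {rmorphism R -> 'F_2}).
Hypothesis rm : residue_map rho 2.
Variables A B C : R.
Local Notation F := (palin A B C).
Local Notation S := (quartic_ring F).
Local Notation red := (@base_change _ _ rho F).
Variable I : S -> Prop.
Hypothesis sI : saturated rho 2 I.

Lemma F2P (x : 'F_2) : x = 0 \/ x = 1.
Proof. by case: x => [[|[|//]] ltx]; [left|right]; apply: val_inj. Qed.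

Local Notation w := (fun x0 x1 x2 x3 : R => row4 x0 x1 x2 x3 : S).
Local Notation r := (fun (s : S) i => rho (s 0 (inord i))).

Lemma red_eq (s t : S) :
  r s 0%N = r t 0%N -> r s 1%N = r t 1%N -> r s 2%N = r t 2%N -> r s 3%N = r t 3%N -> red s = red t.
Proof. by move=> e0 e1 e2 e3; apply: row4P; rewrite [LHS]mxE [RHS]mxE. Qed.

(** Cross terms disappear modulo 2 and elements of ['F_2] are their own squares; the formulas are
    checked on all 2^7 residues. *)
Lemma red_sq (s : S) : let a := rho A in let b := rho B in let c := rho C in
  [/\ r (s * s) 0%N = r s 0%N + a * r s 2%N + a * c * r s 3%N,
      r (s * s) 1%N = b * (r s 1%N + r s 2%N),
      r (s * s) 2%N = a * (r s 1%N + r s 3%N) + c * r s 2%N &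
      r (s * s) 3%N = b * (r s 2%N + r s 3%N)].
Proof.
rewrite /= qmulE !row4E /= !(rmorphB, rmorphD, rmorphM).
case: (F2P (rho A)) => ->; case: (F2P (rho B)) => ->; case: (F2P (rho C)) => ->;
case: (F2P (r s 0%N)) => ->; case: (F2P (r s 1%N)) => ->;
case: (F2P (r s 2%N)) => ->; case: (F2P (r s 3%N)) => ->;
by split; apply/eqP; rewrite ?rmorph1.
Qed.

(** The ramified cases below end by finding in [I] either 1 or, against [sat_idem], a nonzero
    idempotent modulo 2. *)
Lemma sat_one : ~ I 1.
Proof.
by move=> /(sat_nil sI) [n]; rewrite rmorph1 expr1n => /eqP; rewrite oner_eq0.
Qed.

Lemma sat_idem (s : S) : I s -> red (s * s) = red s -> red s = 0.
Proof.
rewrite rmorphM => /(sat_nil sI) [n sn] ss; case: n sn => [|n].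
  by rewrite expr0 => /eqP; rewrite oner_eq0.
suff -> : red s ^+ n.+1 = red s by [].
by elim: n => [|n IHn]; rewrite ?expr1 // exprS IHn.
Qed.

Lemma sat_sub (s t : S) : I (s + t) -> I t -> I s.
Proof.
move=> Ist It; rewrite -(addrK t s) -[- t]mulN1r.
by apply: (sat_add sI) => //; apply: (sat_mul sI).
Qed.

Local Notation P := (4 * A + 2 * B + C).
(* [eta] is w3' and [eps] is w2' + a2' for the form F(x + y, y), whose y^4 and
   x y^3 coefficients are [P] and [2 P]. *)
Local Notation eta := (w (- (5 * A + 2 * B + C)) 1 1 1).
Local Notation eps := (w (5 * A + 2 * B + C) 2 1 0).

(** The multiplication table of the translated form gives eta^2 = - P eps - 2 P eta, which is then
    divided by 2. *)
Lemma sat_eta u : P = 2 * u -> rho u != 0 -> I eta -> I eps.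
Proof.
move=> eu nu Ie; apply: (sat_scale rm sI nu).
have Im : I (- (u *: eps + (2 * u) *: eta)).
  apply: (sat_div sI Ie Ie); rewrite scalerN scalerDr !scalerA -eu.
  by apply: row4P; rewrite qmulE /qmul !(row4E, mxE) /=; ring: eu.
apply: (@sat_sub _ ((2 * u) *: eta)); last by rewrite -scalerA; apply: (sat_pi sI).
by rewrite -[_ + _]opprK -mulN1r; apply: (sat_mul sI).
Qed.

Lemma red_eq0 (s : S) : r s 0%N = 0 -> r s 1%N = 0 -> r s 2%N = 0 -> r s 3%N = 0 -> red s = 0.
Proof.
by move=> e0 e1 e2 e3; rewrite -(rmorph0 red); apply: red_eq; rewrite mxE rmorph0.
Qed.

(* Squaring is linear modulo 2, so the condition on [s] is a linear system. *)
Lemma sq_zero (s : S) : let a := rho A in let b := rho B in let c := rho C in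
  red (s * s) = 0 ->
  [/\ r s 0%N = a * r s 2%N + a * c * r s 3%N, b * r s 1%N = b * r s 2%N,
      c * r s 2%N = a * (r s 1%N + r s 3%N) & b * r s 2%N = b * r s 3%N].
Proof.
move=> a b c ss.
have ss0 i : r (s * s) i = 0.
  by have /rowP /(_ (inord i)) := ss; rewrite !mxE.
have [] := red_sq s; rewrite !ss0 -/a -/b -/c.
case: (F2P a) => ->; case: (F2P b) => ->; case: (F2P c) => ->;
case: (F2P (r s 0%N)) => ->; case: (F2P (r s 1%N)) => ->;
case: (F2P (r s 2%N)) => ->; case: (F2P (r s 3%N)) => ->;
by do 4![move=> /eqP]; move=> // _ _ _ _; split; apply/eqP.
Qed.

Ltac red_calc := apply: red_eq;
  rewrite ?qmulE /qmul !(row4E, mxE) /= ?(rmorphB, rmorphD, rmorphM, rmorphN, rmorph1, rmorph0).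

Hypothesis nP : forall u, P = 2 * u -> rho u != 0.
Hypothesis nABC : ~ [/\ rho A = 0, rho B = 0 & rho C = 0].

(** The only nonzero class with square 0 is that of [eta]. It brings [eps] into [I], and eps^2 is w1
    + w3 modulo 2, a nonzero idempotent. *)
Lemma two_odd_even s : rho B = 1 -> rho C = 0 -> I s ->
  red (s * s) = 0 -> red s = 0.
Proof.
move=> B1 C0 Is /sq_zero; rewrite B1 C0 mulr0 mul0r addr0 !mul1r => -[e0 e1 _ e3].
rewrite -e1 in e0 e3.
have [r1|r1] := F2P (r s 1%N); first by apply: red_eq0; rewrite ?e0 -?e3 -?e1 ?r1 ?mulr0.
have /(residue_ker rm) [u eu] : rho P = 0.
  by rewrite !(rmorphD, rmorphM, rmorph1) B1 C0; case: (F2P (rho A)) => ->; apply/eqP.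
have Ie : I eta.
  apply: (sat_red rm sI _ Is); red_calc; rewrite ?e0 -?e3 -?e1 ?r1 ?B1 ?C0 //.
  by case: (F2P (rho A)) => ->; apply/eqP.
have {}Ie := sat_eta eu (nP eu) Ie.
have Iee : I (eps * eps) by apply: (sat_mul sI).
have [] := red_sq eps; move: (eps * eps) Iee => t It.
rewrite !row4E !(rmorphD, rmorphM, rmorph1, rmorph0) B1 C0 => t0 t1 t2 t3.
have {}t1 : r t 1%N = 1 by rewrite t1; apply/eqP.
have {}t3 : r t 3%N = 1 by rewrite t3; apply/eqP.
have {}t2 : r t 2%N = 0 by rewrite t2; case: (F2P (rho A)) => ->; apply/eqP.
have {}t0 : r t 0%N = 0 by rewrite t0; case: (F2P (rho A)) => ->; apply/eqP.
suff /rowP /(_ (inord 1)) : red t = 0 by rewrite !mxE t1 => /eqP; rewrite oner_eq0.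
apply: (sat_idem It); have [e0' e1' e2' e3'] := red_sq t.
by apply: red_eq; rewrite ?e0' ?e1' ?e2' ?e3' ?t0 ?t1 ?t2 ?t3 ?B1 ?C0;
  case: (F2P (rho A)) => e; rewrite ?e; apply/eqP.
Qed.

(** Modulo 2, F is (x + y)^4, and [eta] and [eps] are (t + 1)^3 and (t + 1)^2. Once [eta], hence
    [eps], is in [I], the element eps^2 / 2 is in [I] and is congruent to the unit - u A modulo
    [eta], [eps] and 2. *)
Lemma two_even s : rho B = 0 -> rho C = 0 -> I s ->
  red (s * s) = 0 -> red s = 0.
Proof.
move=> B0 C0 Is /sq_zero; have A1 : rho A = 1.
  by case: (F2P (rho A)) => // A0; case: nABC.
rewrite A1 B0 C0 !mul1r !mul0r addr0 => -[e0 _ /esym e2 _].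
have {}e2 : r s 3%N = r s 1%N.
  by move: e2; case: (F2P (r s 1%N)) => ->; case: (F2P (r s 3%N)) => -> // /eqP.
(* The classes with square 0 are the multiples of (t + 1)^2, and [w 1 1 0 0] is t + 1 modulo 2. *)
have [//|Ie] : red s = 0 \/ I eta.
  have [r1|r1] := F2P (r s 1%N); have [r2|r2] := F2P (r s 2%N).
  - by left; apply: red_eq0; rewrite ?e0 ?e2 ?r1 ?r2.
  - right; apply: (sat_red rm sI _ (sat_mul sI (w 1 1 0 0) Is)); red_calc;
    by rewrite ?e0 ?e2 ?r1 ?r2 ?A1 ?B0 ?C0; apply/eqP.
  - right; apply: (sat_red rm sI _ (sat_mul sI (w 1 1 0 0) Is)); red_calc;
    by rewrite ?e0 ?e2 ?r1 ?r2 ?A1 ?B0 ?C0; apply/eqP.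
  right; apply: (sat_red rm sI _ Is); red_calc;
  by rewrite ?e0 ?e2 ?r1 ?r2 ?A1 ?B0 ?C0; apply/eqP.
have /(residue_ker rm) [u eu] : rho P = 0.
  by rewrite !(rmorphD, rmorphM, rmorph1) A1 B0 C0; apply/eqP.
have Iep := sat_eta eu (nP eu) Ie.
move: B0 C0 => /(residue_ker rm) [B' eB] /(residue_ker rm) [C' eC].
have eu' : u = 2 * A + 2 * B' + C'.
  apply: subr0_eq; apply: (residue_reg rm).
  by rewrite mulrBr -eu; ring: eB eC.
have Im : I (- (u * A) *: 1 + 2 *: (- u *: w (- A) 1 0 0) + (2 * A + B') *: eta
    + (4 * A + 3 * B' + C') *: eps).
  apply: (sat_div sI Iep Iep).
  by rewrite eu'; apply: row4P; rewrite qmulE /qmul !(row4E, mxE) /=; ring: eB eC.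
have IZ c t : I t -> I (c *: t).
  by move=> /(sat_mul sI (c *: 1)); rewrite -scalerAl mul1r.
have /(sat_scale rm sI _) : I (- (u * A) *: 1).
  by apply: (sat_sub (sat_sub (sat_sub Im (IZ _ _ Iep)) (IZ _ _ Ie)) (sat_pi sI _)).
rewrite rmorphN rmorphM oppr_eq0 mulf_neq0 ?(nP eu) ?A1 // => /(_ isT) I1.
by case: (sat_one I1).
Qed.

Hypothesis nA : rho B = 0 -> rho C = 1 -> forall u, A = 2 * u -> rho u != 0.
Hypothesis nABCsum : rho B = 0 -> rho C = 1 -> forall u, A - B + C = 2 * u -> rho u != 0.

(** Modulo 2, F is x^2 y^2 and w2, w2 + 1 are complementary idempotents; w1 and w3 span the classes
    with square 0, one in each factor. As A is exactly divisible by 2, w1^2 / 2 and w3^2 / 2 are,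
    modulo [I], unit multiples of elements reducing to these idempotents. *)
Lemma two_split s : rho A = 0 -> rho B = 0 -> rho C = 1 -> I s ->
  red (s * s) = 0 -> red s = 0.
Proof.
move=> A0 B0 C1 Is /sq_zero; rewrite A0 B0 C1 !mul0r !mul1r addr0 => -[e0 _ e2 _].
have [u eu] : exists u, A = 2 * u by apply/(residue_ker rm).
have [B' eB] : exists u, B = 2 * u by apply/(residue_ker rm).
have nu := nA B0 C1 eu.
have idem t : I t -> r t 1%N = 0 -> r t 2%N = 1 -> r t 3%N = 0 -> False.
  move=> It t1 t2 t3; suff /rowP /(_ (inord 2)) : red t = 0.
    by rewrite !mxE t2 => /eqP; rewrite oner_eq0.
  apply: (sat_idem It); have [e0' e1' e2' e3'] := red_sq t.
  by apply: red_eq; rewrite ?e0' ?e1' ?e2' ?e3' ?t1 ?t2 ?t3 ?A0 ?B0 ?C1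
    ?(mul0r, mul1r, add0r, addr0).
have [r1|r1] := F2P (r s 1%N); last first.
  have Iw : I (w 0 1 0 0).
    apply: (sat_red rm sI _ (sat_mul sI (w 0 0 1 0) Is)); red_calc;
    rewrite ?e0 ?e2 ?r1 ?A0 ?B0 ?C1;
    by case: (F2P (r s 3%N)) => ->; apply/eqP.
  have Im : I (- B' *: w 0 1 0 0 + u *: w 0 0 1 0).
    apply: (sat_div sI Iw Iw).
    by apply: row4P; rewrite qmulE /qmul !(row4E, mxE) /= ?eB; ring: eu.
  exfalso; apply: (idem (w 0 0 1 0)); rewrite ?row4E ?rmorph0 ?rmorph1 //.
  apply: (sat_scale rm sI nu); apply: (sat_sub (t := - B' *: w 0 1 0 0)).
    by rewrite addrC.
  by have := sat_mul sI (- B' *: 1) Iw; rewrite -scalerAl mul1r.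
have [r3|r3] := F2P (r s 3%N); first exact: red_eq0.
have Iw : I (w 0 0 0 1).
  apply: (sat_red rm sI _ Is); red_calc;
  by rewrite ?e0 ?e2 ?r1 ?r3 ?A0 ?B0 ?C1; apply/eqP.
have Im : I (- B' *: w 0 0 0 1 + - u *: w (C + 2 * A) 0 1 0).
  apply: (sat_div sI Iw Iw).
  by apply: row4P; rewrite qmulE /qmul !(row4E, mxE) /=; ring: eu eB.
exfalso; apply: (idem (w (C + 2 * A) 0 1 0)); rewrite ?row4E ?rmorph0 ?rmorph1 //.
apply: (@sat_scale _ _ _ _ rm _ _ _ _ sI (- u)); first by rewrite rmorphN oppr_eq0.
apply: (sat_sub (t := - B' *: w 0 0 0 1)); first by rewrite addrC.
by have := sat_mul sI (- B' *: 1) Iw; rewrite -scalerAl mul1r.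
Qed.

(** Modulo 2, F is (x^2 + x y + y^2)^2 and the classes with square 0 are the multiples of g = t^2 +
    t + 1, lifted by [w A (- 1) 1 0]. Half the square of this lift is, modulo [I], a unit multiple
    of w2, which is the unit t^2 modulo 2. *)
Lemma two_inert s : rho A = 1 -> rho B = 0 -> rho C = 1 -> I s ->
  red (s * s) = 0 -> red s = 0.
Proof.
move=> A1 B0 C1 Is /sq_zero; rewrite A1 B0 C1 !mul1r => -[e0 _ e2 _].
have {e2} r1 : r s 1%N = r s 2%N + r s 3%N.
  move: e2; case: (F2P (r s 1%N)) => ->; case: (F2P (r s 2%N)) => ->;
  by case: (F2P (r s 3%N)) => -> /eqP // _; apply/eqP.
(* The nonzero multiples of g are g, (t + 1) g and t g; [w 0 1 1 1] and [w 0 0 0 1] invert t + 1 and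
   t modulo g. *)
have [//|Ie] : red s = 0 \/ I (w A (- 1) 1 0).
  have [r2|r2] := F2P (r s 2%N); have [r3|r3] := F2P (r s 3%N);
    rewrite r2 r3 in e0 r1.
  - by left; apply: red_eq0; rewrite ?e0 ?r1 ?r2 ?r3 ?addr0.
  - right; apply: (sat_red rm sI _ (sat_mul sI (w 0 1 1 1) Is)); red_calc;
    by rewrite ?e0 ?r1 ?r2 ?r3 ?A1 ?B0 ?C1; apply/eqP.
  - right; apply: (sat_red rm sI _ Is); red_calc;
    by rewrite ?e0 ?r1 ?r2 ?r3 ?A1 ?B0 ?C1; apply/eqP.
  right; apply: (sat_red rm sI _ (sat_mul sI (w 0 0 0 1) Is)); red_calc;
  by rewrite ?e0 ?r1 ?r2 ?r3 ?A1 ?B0 ?C1; apply/eqP.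
have [u eu] : exists u, A - B + C = 2 * u.
  apply/(residue_ker rm).
  by rewrite !(rmorphB, rmorphD) A1 B0 C1; apply/eqP.
have nu := nABCsum B0 C1 eu.
have [B' eB] : exists u, B = 2 * u by apply/(residue_ker rm).
have eC : C = 2 * u + 2 * B' - A by rewrite -eu -eB; ring.
pose t := w 0 0 (-1) 1.
have It : I t.
  apply: (sat_red rm sI _ (sat_mul sI (w 0 1 0 0) Ie)); red_calc;
  by rewrite ?A1 ?B0 ?C1; apply/eqP.
have Im : I (- u *: w 0 0 1 0 + (B' - A) *: t + 2 *: (u *: w 0 1 0 0)).
  apply: (sat_div sI Ie Ie).
  by apply: row4P; rewrite qmulE /qmul !(row4E, mxE) /=; ring: eB eC.
have /(sat_scale rm sI _) : I (- u *: w 0 0 1 0).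
  apply: (sat_sub (sat_sub Im (sat_pi sI _))).
  by have := sat_mul sI ((B' - A) *: 1) It; rewrite -scalerAl mul1r.
rewrite rmorphN oppr_eq0 nu => /(_ isT) Iw.
have {}Iw : I (w 0 1 0 0).
  apply: (sat_red rm sI _ (sat_mul sI (w 0 0 0 1) Iw)); red_calc;
  by rewrite ?A1 ?B0 ?C1; apply/eqP.
have I1 : I (w 1 0 0 0).
  apply: (sat_red rm sI _ (sat_mul sI (w 0 0 0 1) Iw)); red_calc;
  by rewrite ?A1 ?B0 ?C1; apply/eqP.
by case: (sat_one I1).
Qed.

Lemma two_red_sq s : I s -> red (s * s) = 0 -> red s = 0.
Proof.
move=> Is ss; have [B0|B1] := F2P (rho B); have [C0|C1] := F2P (rho C).
- exact: two_even.
- have [A0|A1] := F2P (rho A); [exact: two_split|exact: two_inert].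
- exact: two_odd_even.
(* For B and C odd, squaring is injective modulo 2. *)
have := sq_zero ss; rewrite B1 C1 !mul1r mulr1 => -[e0 e1 + e3].
rewrite e1 e3; have [r3|r3] := F2P (r s 3%N); last first.
  by rewrite r3; case: (F2P (rho A)) => -> /eqP.
by move=> _; apply: red_eq0; rewrite ?e0 ?e1 ?e3 ?r3 // !mulr0 addr0.
Qed.

(** Iterated squaring kills a nilpotent class, so induction on the number of squarings reduces to
    square 0. *)
Lemma two_red_eq0 s : I s -> red s = 0.
Proof.
move=> Is; have [n sn] := sat_nil sI Is.
have {sn} : red s ^+ (2 ^ n) = 0.
  by rewrite -(subnK (ltnW (ltn_expl n (ltnSn 1)))) exprD sn mulr0.
elim: n s Is => [|n IHn] s Is; first by rewrite expr1.
rewrite expnS exprM expr2 -rmorphM => /IHn ss; apply: two_red_sq => //.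
by apply: ss; apply: (sat_mul sI).
Qed.

End Two.

(** * Conditions on integral coefficients *)

Lemma map_palin_int (R : comNzRingType) (A B C : int) :
  map_bqf (intr : int -> R) (BQF A B (C + 2 * A) B A) = palin A%:~R B%:~R C%:~R.
Proof. by rewrite /map_bqf /= rmorphD rmorphM. Qed.

Section AtPrime.
Variables (p : nat) (p_pr : prime p) (A B C : int).
Local Notation F := (BQF A B (C + 2 * A) B A).
Local Notation Zp := (padic_int p).
Local Notation rho := (padic_rho p_pr).
Local Notation pi := (p%:R : Zp).
Let rm := padic_residue_map p_pr.

Lemma dvdz_padic (z : int) (x : Zp) : z%:~R = pi * x -> (p %| z)%Z.
Proof.
move=> e; rewrite -(padic_rho_int p_pr); apply/eqP.
by apply/(residue_ker rm); exists x.
Qed.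

Lemma dvdz_sq_padic (z : int) (u : Zp) : (z != 0 %[mod p%:Z ^+ 2])%Z ->
  z%:~R = pi * u -> rho u != 0.
Proof.
move=> nz e; have /dvdzP [y ey] := dvdz_padic e.
have {e} : y%:~R = u.
  apply: subr0_eq; apply: (residue_reg rm); rewrite mulrBr -e ey.
  by rewrite rmorphM mulrC subrr.
move=> <-; rewrite padic_rho_int //; apply: contra nz => /dvdzP [q eq].
by rewrite ey eq -mulrA -expr2 mod0z modzMl.
Qed.

Lemma pi_not_unit (x : Zp) : pi * x <> 1.
Proof.
move=> /(congr1 rho) /eqP; rewrite rmorphM (residue_pi rm) mul0r rmorph1.
by rewrite eq_sym oner_eq0.
Qed.

Lemma maximal_palin :
  (forall I, saturated rho pi I ->
     forall a : quartic_ring (palin A%:~R B%:~R C%:~R), I a ->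
       base_change rho a = 0) ->
  maximal_at p F.
Proof.
rewrite /maximal_at /padic_quartic_ring map_palin_int.
exact: (maximal_saturated rm).
Qed.

Let not_max (G : bqf Zp) : map_bqf intr F = G ->
  ~ maximal_quartic_ring (quartic_ring G) -> ~ maximal_at p F.
Proof. by rewrite /maximal_at /padic_quartic_ring => ->. Qed.

Lemma maximal_not_content : maximal_at p F ->
  ~ [/\ (p %| A)%Z, (p %| B)%Z & (p %| C)%Z].
Proof.
move=> max [/dvdzP [a ea] /dvdzP [b eb] /dvdzP [c ec]]; move: max.
apply: (@not_max (map_bqf ( *%R pi)
  (BQF a%:~R b%:~R (c + 2 * a)%:~R b%:~R a%:~R))).
  by rewrite map_palin_int ea eb ec /palin /map_bqf /=; congr BQF; ring.
exact: (not_maximal_content (residue_reg rm) pi_not_unit).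
Qed.

Lemma maximal_not_double_root (r : int) : maximal_at p F ->
  (p %| 4 * A * r ^+ 3 + 3 * B * r ^+ 2 + 2 * (C + 2 * A) * r + B)%Z ->
  ~ (p%:Z ^+ 2 %| A * r ^+ 4 + B * r ^+ 3 + (C + 2 * A) * r ^+ 2 + B * r + A)%Z.
Proof.
move=> max /dvdzP [v ev] /dvdzP [u eu]; move: max.
apply: (@not_max (map_bqf intr F)) => //; rewrite /map_bqf /=.
apply: (not_maximal_double_root (residue_reg rm) pi_not_unit (r := r%:~R)
  (u := u%:~R) (v := v%:~R)).
  transitivity ((A * r ^+ 4 + B * r ^+ 3 + (C + 2 * A) * r ^+ 2 + B * r + A)%:~R : Zp).
    by ring.
  by rewrite eu; ring.
transitivity ((4 * A * r ^+ 3 + 3 * B * r ^+ 2 + 2 * (C + 2 * A) * r + B)%:~R : Zp).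
  by ring.
by rewrite ev; ring.
Qed.

Lemma maximal_not_square (s b c : Zp) :
  B%:~R = 2 * A%:~R * s + pi * b ->
  C%:~R = A%:~R * s ^+ 2 + pi * b * s + pi ^+ 2 * c ->
  ~ maximal_at p F.
Proof.
move=> eB eC.
apply: not_max (@not_maximal_square _ pi (residue_reg rm) pi_not_unit A%:~R s b c).
by rewrite map_palin_int /palin eC -eB; congr BQF; ring.
Qed.

(** By the palindromic symmetry the derivative of F(x, 1) at 1 and at - 1 is 2 and - 2 times the
    value, so a value divisible by p^2 is already a double root. *)
Lemma maximal_values : maximal_at p F ->
  ~~ (p%:Z ^+ 2 %| 4 * A + 2 * B + C)%Z /\ ~~ (p%:Z ^+ 2 %| 4 * A - 2 * B + C)%Z.
Proof.
move=> max; have p_p2 : (p%:Z %| p%:Z ^+ 2)%Z by rewrite expr2 dvdz_mulr.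
split; apply/negP => p2.
  apply: (maximal_not_double_root (r := 1) max).
    rewrite (_ : _ + B = 2 * (4 * A + 2 * B + C)); last by ring.
    by apply/dvdz_mull/(dvdz_trans p_p2).
  by rewrite (_ : _ + A = 4 * A + 2 * B + C) //; ring.
apply: (maximal_not_double_root (r := - 1) max).
  rewrite (_ : _ + B = - 2 * (4 * A - 2 * B + C)); last by ring.
  by apply/dvdz_mull/(dvdz_trans p_p2).
by rewrite (_ : _ + A = 4 * A - 2 * B + C) //; ring.
Qed.

Lemma neq0_modz (x m : int) : (x != 0 %[mod m])%Z = ~~ (m %| x)%Z.
Proof. by rewrite eqz_mod_dvd subr0. Qed.

Lemma prime_dvdzM (x y : int) : (p %| x * y)%Z = (p %| x)%Z || (p %| y)%Z.
Proof. by rewrite !dvdzE abszM Euclid_dvdM. Qed.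

Lemma maximal_disc : odd p -> maximal_at p F ->
  ~~ (p%:Z ^+ 2 %| B ^+ 2 - 4 * A * C)%Z.
Proof.
move=> p_odd max; apply/negP => p2.
have p_p2 : (p%:Z %| p%:Z ^+ 2)%Z by rewrite expr2 dvdz_mulr.
have p_ndvd2 : ~~ (p %| 2)%Z.
  by rewrite dvdzE /= dvdn_prime2 //; apply: contraTneq p_odd => ->.
(* If [p] divides A, it divides B but not C, so p^2 divides A and 0 is a double root. *)
have [pA|pA] := boolP (p %| A)%Z.
  have pB : (p %| B)%Z.
    have : (p %| B ^+ 2)%Z.
      rewrite -[B ^+ 2](subrK (4 * A * C)) rpredD ?(dvdz_trans p_p2 p2) //.
      by rewrite !prime_dvdzM pA orbT.
    by rewrite expr2 prime_dvdzM orbb.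
  have pC : ~~ (p %| C)%Z.
    by apply/negP => pC; apply: (maximal_not_content max).
  apply: (maximal_not_double_root (r := 0) max); first by rewrite !(mulr0, expr0n, add0r).
  rewrite !(mulr0, expr0n, add0r) /=.
  have : (p%:Z ^+ 2 %| A * (4 * C))%Z.
    rewrite (_ : A * (4 * C) = B ^+ 2 - (B ^+ 2 - 4 * A * C)); last by ring.
    by rewrite rpredB // expr2 expr2 dvdz_mul.
  rewrite Gauss_dvdzl // coprimezE abszX coprimeXl // prime_coprime //.
  rewrite -[(_ %| _)%N]/(p %| 4 * C)%Z.
  by rewrite (_ : 4 = 2 * 2) // !prime_dvdzM negb_or pC negb_or p_ndvd2.
have rhoA : rho A%:~R != 0 by rewrite padic_rho_int.
have rho2 : rho 2 != 0 by rewrite -(padic_rho_int p_pr 2) in p_ndvd2.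
have [a Aa] := residue_unit rm rhoA; have [h h2] := residue_unit rm rho2.
have /dvdzP [d ed] := p2.
have eD : B%:~R ^+ 2 - 4 * A%:~R * C%:~R = pi ^+ 2 * d%:~R :> Zp.
  transitivity ((B ^+ 2 - 4 * A * C)%:~R : Zp); first by ring.
  by rewrite ed; ring.
(* Completing the square: s = B / (2 A), and the remaining term is - D / (4 A) v^2 with D = p^2
   d. *)
case: (@maximal_not_square (B%:~R * a * h) 0 (- (d%:~R * a * h ^+ 2))) => //.
  transitivity (B%:~R * (A%:~R * a) * (2 * h) : Zp); last by ring.
  by rewrite Aa h2 !mulr1.
apply: subr0_eq; apply: (eq0_lincomb3 (- (B%:~R ^+ 2 * a * h ^+ 2) - C%:~R * (2 * h) ^+ 2)
  (- (C%:~R * (2 * h + 1))) (- (a * h ^+ 2)) Aa h2 eD).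
by ring.
Qed.

End AtPrime.

Lemma maximal_at_odd (p : nat) (A B C : int) : prime p -> odd p ->
  maximal_at p (BQF A B (C + 2 * A) B A) <->
     [/\ ~ [/\ (p %| A)%Z, (p %| B)%Z & (p %| C)%Z],
         (4 * A + 2 * B + C != 0 %[mod p%:Z ^+ 2])%Z,
         (4 * A - 2 * B + C != 0 %[mod p%:Z ^+ 2])%Z &
         (B ^+ 2 - 4 * A * C != 0 %[mod p%:Z ^+ 2])%Z].
Proof.
move=> p_pr p_odd; split=> [max|[nABC nP nN nD]].
  have [nP nN] := maximal_values p_pr max; rewrite !neq0_modz; split=> //.
    exact (maximal_not_content p_pr max).
  exact: (maximal_disc p_pr).
apply (@maximal_palin _ p_pr A B C) => I sI a Ia.
have two_neq0 : padic_rho p_pr 2 != 0.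
  rewrite (padic_rho_int p_pr 2) dvdzE /= dvdn_prime2 //.
  by apply: contraTneq p_odd => ->.
apply: (odd_red_eq0 (padic_residue_map p_pr) two_neq0 sI) Ia.
- move=> u e; apply: (dvdz_sq_padic p_pr nP); rewrite -e; ring.
- move=> u e; apply: (dvdz_sq_padic p_pr nN); rewrite -e; ring.
- move=> u e; apply: (dvdz_sq_padic p_pr nD); rewrite -e; ring.
by move=> [/eqP + /eqP + /eqP]; rewrite !padic_rho_int => *; apply: nABC.
Qed.

Lemma maximal_at_two (A B C : int) :
  maximal_at 2 (BQF A B (C + 2 * A) B A) <->
     [/\ ~ [/\ (2 %| A)%Z, (2 %| B)%Z & (2 %| C)%Z],
         (2 * B + C != 0 %[mod 4])%Z &
         (~~ (2 %| C)%Z -> (2 %| B)%Z ->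
            (A != 0 %[mod 4])%Z /\ (A - B + C != 0 %[mod 4])%Z)].
Proof.
have p_pr : prime 2 by [].
have P4 : (2 * B + C != 0 %[mod 4])%Z = (4 * A + 2 * B + C != 0 %[mod 2%:Z ^+ 2])%Z.
  rewrite !neq0_modz (_ : 4 * A + 2 * B + C = A * 4 + (2 * B + C)); last by ring.
  by rewrite [2%:Z ^+ 2](_ : _ = 4) // [in RHS]rpredDl // dvdz_mull.
split=> [max|[nABC nP nAS]].
  have [nP _] := maximal_values p_pr max.
  split; [exact (maximal_not_content p_pr max)|by rewrite P4 neq0_modz|].
  move=> oC /dvdzP [b eb]; rewrite !neq0_modz; split; apply/negP.
    move=> A4; apply: (maximal_not_double_root p_pr (r := 0) max).
      by rewrite !(mulr0, expr0n, add0r) eb dvdz_mull.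
    by rewrite !(mulr0, expr0n, add0r).
  move=> /dvdzP [c ec].
  (* With g = u + v, the form f is A g^2 + (B - 2 A) g v + (A - B + C) v^2; here B - 2 A is even and
     A - B + C is divisible by 4. *)
  apply: (maximal_not_square p_pr (s := 1) (b := b%:~R - A%:~R) (c := c%:~R) _ _ max).
    by rewrite eb; ring.
  have -> : C = c * 4 - A + B by rewrite -ec; ring.
  by rewrite eb; ring.
apply (@maximal_palin _ p_pr A B C) => I sI a Ia.
have rho0 z : padic_rho p_pr z%:~R = 0 -> (2 %| z)%Z.
  by move=> /eqP; rewrite padic_rho_int.
have rho1 z : padic_rho p_pr z%:~R = 1 -> ~~ (2 %| z)%Z.
  by rewrite -(padic_rho_int p_pr) => ->; apply: oner_neq0.
apply: (two_red_eq0 (padic_residue_map p_pr) sI) Ia.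
- move=> u e; apply: (dvdz_sq_padic p_pr (z := 4 * A + 2 * B + C)).
    by rewrite -P4.
  by rewrite -e; ring.
- by move=> [/rho0 ? /rho0 ? /rho0 ?]; apply: nABC.
- move=> /rho0 dB /rho1 oC u e; have [nA _] := nAS oC dB.
  exact: (dvdz_sq_padic p_pr nA).
move=> /rho0 dB /rho1 oC u e; have [_ nS] := nAS oC dB.
by apply: (dvdz_sq_padic p_pr nS); rewrite -e; ring.
Qed.

Theorem theorem4p2 (A B C : int) :
  let F : bqf int := BQF A B (C + 2 * A) B A in
  (forall p : nat, prime p -> odd p ->
     maximal_at p F <->
     [/\ ~ [/\ (p %| A)%Z, (p %| B)%Z & (p %| C)%Z],
         (4 * A + 2 * B + C != 0 %[mod p%:Z ^+ 2])%Z,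
         (4 * A - 2 * B + C != 0 %[mod p%:Z ^+ 2])%Z &
         (B ^+ 2 - 4 * A * C != 0 %[mod p%:Z ^+ 2])%Z])
  /\
  (maximal_at 2 F <->
     [/\ ~ [/\ (2 %| A)%Z, (2 %| B)%Z & (2 %| C)%Z],
         (2 * B + C != 0 %[mod 4])%Z &
         (~~ (2 %| C)%Z -> (2 %| B)%Z ->
            (A != 0 %[mod 4])%Z /\ (A - B + C != 0 %[mod 4])%Z)]).
Proof.
by split=> [p p_pr p_odd|]; [apply: maximal_at_odd|apply: maximal_at_two].
Qed.
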